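(* Let $H\in(0,1)$ and let $X^H_t=x_0+B^H_t+\int_0^t\zeta_s\,ds$, $0\le t\le1$, where $x_0\in\mathbb R$, $B^H$ is a fractional Brownian motion with Hurst parameter $H$ on a probability space $(\widetilde\Omega,\mathcal G,\mathbb Q)$, and $\zeta$ is progressively measurable with respect to the natural filtration of $B^H$ and satisfies: if $H\le1/2$, there is a finite random variable $C$ such that $|\zeta_t(\omega)|\le C(\omega)$ for a.e. $t$ and $\mathbb Q$-a.e. $\omega$; if $H>1/2$, the function $t\mapsto\zeta_t$ is $\mathbb Q$-a.s. Hölder continuous with some exponent $\alpha>2H-1$. Then $\mathbb Q$-almost all sample paths of $X^H$ satisfy the reverse Jensen condition and admit the roughness exponent $H$. Moreover, the estimator $\widehat R_n$ is strongly consistent, i.e. $\widehat R_n(X^H)\to H$ $\mathbb Q$-a.s., and there exists a positive constant $\kappa$ such that $$\limsup_{n\uparrow\infty}\frac{|\widehat R_n(X^H)-H|}{\varepsilon_n}\le\kappa\qquad\mathbb Q\text{-a.s.},$$ where $$\varepsilon_n=\begin{cases}2^{-n/2}n^{-1}\sqrt{\log n}&\text{if }H\in(0,\frac12),\\ 2^{-n/2}n^{-1/2}\sqrt{\log n}&\text{if }H=\frac12,\\ 2^{(H-1)n}n^{-1}\sqrt{\log n}&\text{if }H\in(\frac12,1).\end{cases}$$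
   Context: For $x\in C[0,1]$ nonconstant, $p>0$ and $n\in\mathbb N$, let $\langle x\rangle_n^{(p)}:=\sum_{k=0}^{2^n-1}|x((k+1)2^{-n})-x(k2^{-n})|^p$. The function $x$ admits the roughness exponent $R:=1/q$ (with $1/\infty:=0$) if there exists $q\in[1,\infty]$ such that $\lim_{n}\langle x\rangle_n^{(p)}=0$ for every $p>q$ and $\lim_n\langle x\rangle_n^{(p)}=\infty$ for every $0<p<q$. The Faber--Schauder coefficients of $x$ are $\theta_{m,k}:=2^{m/2}\big(2x(\tfrac{2k+1}{2^{m+1}})-x(\tfrac{k}{2^m})-x(\tfrac{k+1}{2^m})\big)$ for $m\in\mathbb N_0$, $k=0,\dots,2^m-1$. For $n\in\mathbb N$ set $s_n:=\sqrt{\sum_{m=0}^{n-1}\sum_{k=0}^{2^m-1}\theta_{m,k}^2}$ and $\widehat R_n(x):=1-\frac1n\log_2 s_n$. A positive function $\varrho$ is subexponential if $\frac1t\log\varrho(t)\to0$ as $t\uparrow\infty$. The function $x$ (i.e. its Faber--Schauder coefficients) satisfies the reverse Jensen condition if for each $p\ge1$ there exist $n_p\in\mathbb N$ and a non-decreasing subexponential function $\varrho_p:\mathbb N\to[1,\infty)$ such that for all $n\ge n_p$, $$\frac1{\varrho_p(n)} s_n^p\le \frac1{2^{n-1}}\sum_{k=0}^{2^{n-1}-1}\Big(\sum_{m=0}^{n-1}2^m\theta^2_{m,\lfloor 2^{m-n+1}k\rfloor}\Big)^{p/2}\le\varrho_p(n)s_n^{p}.$$ For the process, $\widehat R_n(X^H)$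 denotes $\widehat R_n$ evaluated at the sample path $t\mapsto X^H_t$. *)

(* Defs.v *)
From HB Require Import structures.
From mathcomp Require Import all_boot all_order all_algebra.
From mathcomp Require Import all_classical all_reals all_analysis.

Set Implicit Arguments.
Unset Strict Implicit.
Unset Printing Implicit Defensive.

Import Order.TTheory GRing.Theory Num.Theory.
Import numFieldNormedType.Exports.

Local Open Scope classical_set_scope.
Local Open Scope ring_scope.

(** Functions on [0, 1] are represented by functions [R -> R]; only their
    values on [0, 1] are used. *)

Section pathwise.
Context {R : realType}.
Implicit Types (x : R -> R) (p : R) (m n k : nat).

Definition pvariation x p n : R :=
  \sum_(0 <= k < 2 ^ n)
    `|x (k.+1%:R / 2 ^+ n) - x (k%:R / 2 ^+ n)| `^ p.

(** On [\bar R], [(+oo)^-1 = 0], so that [q = +oo] gives the exponent [0]. *)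
Definition roughness_exponent x (r : R) : Prop :=
  [/\ {within `[0, 1], continuous x},
      exists s t : R, [/\ 0 <= s <= 1, 0 <= t <= 1 & x s != x t]
    & exists q : \bar R,
        [/\ (1 <= q)%E, (r%:E = q^-1)%E,
            forall p, (q < p%:E)%E -> pvariation x p n @[n --> \oo] --> 0
          & forall p, 0 < p -> (p%:E < q)%E ->
              pvariation x p n @[n --> \oo] --> +oo]].

Definition faber_schauder x m k : R :=
  2 `^ (m%:R / 2) *
  (2 * x ((2 * k + 1)%:R / 2 ^+ m.+1)
   - x (k%:R / 2 ^+ m) - x (k.+1%:R / 2 ^+ m)).

Definition fs_norm x n : R :=
  Num.sqrt (\sum_(0 <= m < n) \sum_(0 <= k < 2 ^ m) faber_schauder x m k ^+ 2).

Definition log2 (y : R) : R := ln y / ln 2.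

Definition rough_estimator x n : R := 1 - n%:R^-1 * log2 (fs_norm x n).

Definition subexponential (rho : nat -> R) : Prop :=
  n%:R^-1 * ln (rho n) @[n --> \oo] --> 0.

(** For [0 <= m <= n - 1], [k %/ 2 ^ (n - 1 - m)] is the floor of
    [2 ^ (m - n + 1) * k]. *)
Definition jensen_mean x p n : R :=
  (2 ^+ n.-1)^-1 *
  \sum_(0 <= k < 2 ^ n.-1)
    (\sum_(0 <= m < n)
       2 ^+ m * faber_schauder x m (k %/ 2 ^ (n.-1 - m)) ^+ 2) `^ (p / 2).

Definition reverse_jensen x : Prop :=
  forall p, 1 <= p ->
  exists (np : nat) (rho : nat -> R),
    [/\ (0 < np)%N, forall n, 1 <= rho n,
        {homo rho : m n / (m <= n)%N >-> m <= n},
        subexponential rho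
      & forall n, (np <= n)%N ->
          (rho n)^-1 * fs_norm x n `^ p <= jensen_mean x p n
            <= rho n * fs_norm x n `^ p].

Definition hoelder_on01 (a : R) x : Prop :=
  exists K : R, forall s t, 0 <= s <= 1 -> 0 <= t <= 1 ->
    `|x s - x t| <= K * `|s - t| `^ a.

Definition rate (H : R) n : R :=
  if H < 2^-1 then 2 `^ (- (n%:R / 2)) * n%:R^-1 * Num.sqrt (ln n%:R)
  else if H == 2^-1
  then 2 `^ (- (n%:R / 2)) * n%:R `^ (- 2^-1) * Num.sqrt (ln n%:R)
  else 2 `^ ((H - 1) * n%:R) * n%:R^-1 * Num.sqrt (ln n%:R).

End pathwise.

Section processes.
Context {R : realType} {d : measure_display} {T : measurableType d}.
Variable P : probability T R.

(** The library's [normal_prob m s] is a junk value for [s = 0], hence the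
    separate case of degenerate Gaussian laws. *)
Definition gaussian (Y : T -> R) : Prop :=
  exists m s : R, forall V : set R, measurable V ->
    pushforward P Y V = if s == 0 then \d_m V else normal_prob m s V.

Definition gaussian_process01 (B : R -> {RV P >-> R}) : Prop :=
  forall (n : nat) (t a : 'I_n -> R), (forall i, 0 <= t i <= 1) ->
    gaussian (fun w => \sum_(i < n) a i * B (t i) w).

Definition fractional_brownian_motion (H : R) (B : R -> {RV P >-> R}) : Prop :=
  [/\ gaussian_process01 B,
      forall t, 0 <= t <= 1 -> ('E_P[B t] = 0)%E,
      forall s t, 0 <= s <= 1 -> 0 <= t <= 1 ->
        covariance P (B s) (B t) =
        ((s `^ (2 * H) + t `^ (2 * H) - `|t - s| `^ (2 * H)) / 2)%:E
    & {ae P, forall w, {within `[0, 1], continuous (fun t => B t w)}}].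

(** A generating family of the sigma-algebra sigma(B_s : 0 <= s <= t). *)
Definition natural_filtration_gen (B : R -> {RV P >-> R}) (t : R) : set (set T) :=
  \bigcup_(s in `[0, t]) g_sigma_algebra_preimage (B s).

Definition progressively_measurable (G : R -> set (set T))
    (zeta : R -> T -> R) : Prop :=
  forall t : R, 0 <= t <= 1 ->
    measurable_fun (`[0, t] `*` setT)
      (fun z : R * g_sigma_algebraType (G t) => zeta z.1 z.2).

Definition drifted (x0 : R) (B : R -> {RV P >-> R}) (zeta : R -> T -> R)
    (t : R) (w : T) : R :=
  x0 + B t w + (\int[lebesgue_measure]_(s in `[0, t]) zeta s w)%R.

End processes.

(* Main.v *)
Require Import Defs.
From HB Require Import structures.
From mathcomp Require Import all_boot all_order all_algebra.
From mathcomp Require Import all_classical all_reals all_analysis.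
From mathcomp Require Import measurable_realfun.
From mathcomp Require Import ring lra.

(** All conclusions follow from two properties of a path: a modulus of continuity
    on the dyadic points, and the concentration of its dyadic quadratic variation.
    Fractional Brownian motion has both almost surely, and a Lipschitz drift does
    not destroy them.

    Paths.  Let [Q n] be the sum of the squared increments of a path [x] over the
    dyadic intervals of level [n].  By the parallelogram identity the squared
    Faber-Schauder coefficients telescope ([sqr_fs_norm]), so the squared norm that
    enters the estimator is [2 ^+ n * Q n] minus a constant.  Suppose that
    [2 `^ ((2 * H - 1) * n) * Q n] tends to one with an error of order
    [fluctuation H n].  Then the logarithm of the norm is known up to that error,
    and dividing by [n] gives the consistency and the rate ([path_consistent],
    [path_rate]).  Suppose moreover that the increments of level [n] are at most
    [C * n.+1 * 2 `^ (- (H * n))].  Then the squared increments, and likewise the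
    energies in the reverse Jensen condition, have a maximum that exceeds their
    mean by a polynomial factor only.  In such a family at least an inverse
    polynomial fraction of the terms is of the order of the mean, so all power means
    are comparable up to polynomial factors ([sum_powR_ge], [sum_powR_le]).  This yields the reverse
    Jensen condition and the roughness exponent ([path_reverse_jensen],
    [path_roughness_exponent]).

    Fractional Brownian motion.  The modulus of continuity is a union bound over
    the Gaussian increments of each level ([fbm_ae_modulus]).  For the quadratic
    variation, the increments of level [n], scaled to total variance one, form a
    Gaussian vector whose covariance matrix has norm at most
    [level_norm H n = 2 * 2 `^ (- (2 * hurst_gap H) * n)]: the off-diagonal entries
    have one sign and telescope, so the absolute row sums are explicit
    ([sum_norm_second_difference], [scaled_cov_le]).  A Gaussian sum of squares with
    trace one and norm [L] deviates from one by [t] with probability at most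
    [expR (- (t ^+ 2 / (32 * L)))] ([concentration_squares]), and a deviation of
    [16 * fluctuation H n] has summable probabilities ([fbm_ae_concentrated]).

    The bound on the Laplace transform of the sum of squares avoids
    diagonalisation and densities in several variables.  One square is removed
    at a time: [expR (c / 2 * y ^+ 2)] is the Laplace transform of an independent
    Gaussian variable for [c > 0], and its characteristic function for [c < 0]
    ([integral_expR_squares], [integral_expR_squares_cos]).  Averaging over that
    variable last leaves a one-dimensional Gaussian integral and tilts the
    covariance form by a rank one term; the tilted forms are compared with the
    original one by completing squares ([tilted_form_le], [tilt_mass_le]).

    Drift.  In both cases of the hypothesis the density of the drift is almost
    surely bounded, so the drift is Lipschitz and its increments of level [n] are
    of order [2 ^- n].  This moves the normalised quadratic variation by
    [2 `^ (- (1 - H) * n)] at most, up to a constant, and [hurst_gap H <= 1 - H], so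
    the factor [Num.sqrt (ln n)] in the fluctuation absorbs it
    ([perturbed_concentration]).  The first part then applies to the paths of the
    drifted process. *)

Set Implicit Arguments.
Unset Strict Implicit.
Unset Printing Implicit Defensive.
Import Order.TTheory GRing.Theory Num.Theory.
Import numFieldNormedType.Exports.
Local Open Scope classical_set_scope.
Local Open Scope ring_scope.

(** * Gaussian integrals *)

Section normal_law.
Context {R : realType}.
Implicit Types (m s u c a : R).
Local Notation mu := (@lebesgue_measure R).

(** The density is identified with the Radon-Nikodym derivative only almost
    everywhere, by comparing integrals over measurable sets. *)
Lemma ge0_integral_normal_prob m s (f : R -> \bar R) :
  measurable_fun setT f -> (forall x, 0 <= f x)%E ->
  (\int[normal_prob m s]_x f x = \int[mu]_x (f x * (normal_pdf m s x)%:E))%E.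
Proof.
move=> mf f0; have dom := @normal_prob_dominates R m s.
rewrite -(Radon_Nikodym_SigmaFinite.change_of_variables dom)//.
apply: ae_eq_integral => //.
- apply: emeasurable_funM => //; apply: (measurable_int mu).
  exact: Radon_Nikodym_SigmaFinite.f_integrable.
- apply: emeasurable_funM => //.
  by apply/measurable_EFinP; exact: measurable_normal_pdf.
- apply: ae_eqe_mul2l; apply: integral_ae_eq => //.
  + exact: Radon_Nikodym_SigmaFinite.f_integrable.
  + by apply/measurable_EFinP; exact: measurable_normal_pdf.
  + by move=> E _ mE; rewrite -Radon_Nikodym_SigmaFinite.f_integral.
Qed.

Lemma integral_normal_prob m s (f : R -> R) : measurable_fun setT f ->
  (\int[normal_prob m s]_x (f x)%:E =
   \int[mu]_x (f x * normal_pdf m s x)%:E)%E.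
Proof.
move=> mf.
rewrite integralE [RHS]integralE !ge0_integral_normal_prob//; last 2 first.
- exact/measurable_funeneg/measurable_EFinP.
- exact/measurable_funepos/measurable_EFinP.
congr (_ - _)%E; apply: eq_integral => x _.
- rewrite !funeposE -EFin_max -EFinM -EFin_max; congr EFin.
  by rewrite maxr_pMl ?normal_pdf_ge0// mul0r.
- rewrite !funenegE -!EFinN -EFin_max -EFinM -EFin_max; congr EFin.
  by rewrite maxr_pMl ?normal_pdf_ge0// mul0r mulNr.
Qed.

End normal_law.

(** Completing the square: the right-hand side exhibits the mean and the
    variance of the tilted law. *)
Lemma tilt_exponent (R : realType) (s c a x : R) : s != 0 -> 1 - c * s ^+ 2 != 0 ->
  a * x + c / 2 * x ^+ 2 - x ^+ 2 / (s ^+ 2 *+ 2) =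
  a ^+ 2 * s ^+ 2 / (2 * (1 - c * s ^+ 2))
  - (x - a * s ^+ 2 / (1 - c * s ^+ 2)) ^+ 2 / (s ^+ 2 / (1 - c * s ^+ 2) *+ 2).
Proof.
move=> s0 D0; rewrite -(mulr_natr (s ^+ 2 / _)) -(mulr_natr (s ^+ 2)).
field; by rewrite D0 s0.
Qed.

(** Exponential tilting turns a Gaussian density into a Gaussian density. *)
Lemma normal_pdf_tilt (R : realType) (s a c x : R) : s != 0 -> 0 < 1 - c * s ^+ 2 ->
  expR (a * x + c / 2 * x ^+ 2) * normal_pdf 0 s x =
  (Num.sqrt (1 - c * s ^+ 2))^-1 *
  expR (a ^+ 2 * s ^+ 2 / (2 * (1 - c * s ^+ 2))) *
  normal_pdf (a * s ^+ 2 / (1 - c * s ^+ 2)) (s / Num.sqrt (1 - c * s ^+ 2)) x.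
Proof.
move=> s0 d0; have D0 : 1 - c * s ^+ 2 != 0 by rewrite gt_eqF.
have sD0 : Num.sqrt (1 - c * s ^+ 2) != 0 by rewrite gt_eqF// sqrtr_gt0.
rewrite !normal_pdfE//; last by rewrite mulf_neq0// invr_neq0.
have e1 : (s / Num.sqrt (1 - c * s ^+ 2)) ^+ 2 = s ^+ 2 / (1 - c * s ^+ 2).
  by rewrite expr_div_n sqr_sqrtr// ltW.
have e2 : normal_peak (s / Num.sqrt (1 - c * s ^+ 2)) =
    normal_peak s * Num.sqrt (1 - c * s ^+ 2).
  rewrite /normal_peak e1 (mulrAC (s ^+ 2)) -(mulrnAl (s ^+ 2 * pi) _ 2) sqrtrM.
    by rewrite sqrtrV ?(ltW d0)// invfM invrK.
  by apply: mulrn_wge0; rewrite mulr_ge0 ?sqr_ge0 ?pi_ge0.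
rewrite e2 /normal_fun e1 subr0.
rewrite mulrCA -expRD mulNr tilt_exponent// expRD mulNr.
set A := expR _; set B := expR _; set p := normal_peak _; set q := Num.sqrt _.
transitivity ((q^-1 * q) * (p * (A * B))); last by rewrite !mulrA; ring.
by rewrite mulVf// mul1r.
Qed.

Section gaussian_laplace.
Context {R : realType}.
Implicit Types (m s u c a : R).
Local Notation mu := (@lebesgue_measure R).

(** After tilting, the integrand is a multiple of a Gaussian density, so that
    the integral is the multiple.  The condition on [c] says that the quadratic
    term does not destroy the Gaussian decay. *)
Lemma normal_mgf m s a c : s != 0 -> 0 < 1 - c * s ^+ 2 ->
  (\int[normal_prob m s]_x (expR (a * (x - m) + c / 2 * (x - m) ^+ 2))%:E =
  ((Num.sqrt (1 - c * s ^+ 2))^-1 *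
   expR (a ^+ 2 * s ^+ 2 / (2 * (1 - c * s ^+ 2))))%:E)%E.
Proof.
move=> s0 d0; have mf : measurable_fun [set: R]
    (fun x => expR (a * (x - m) + c / 2 * (x - m) ^+ 2)).
  apply: measurableT_comp => //; apply: measurable_funD.
    by apply: measurable_funM => //; exact: measurable_funB.
  by apply: measurable_funM => //; apply: measurable_funX; exact: measurable_funB.
have sD0 : s / Num.sqrt (1 - c * s ^+ 2) != 0.
  by rewrite mulf_neq0// invr_neq0// gt_eqF// sqrtr_gt0.
rewrite integral_normal_prob//.
set k := (Num.sqrt _)^-1 * _; set m' := a * s ^+ 2 / (1 - c * s ^+ 2).
transitivity (\int[mu]_x (k%:E * (normal_pdf (m' + m) (s / Num.sqrt (1 - c * s ^+ 2)) x)%:E))%E.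
  apply: eq_integral => x _; rewrite -EFinM; congr EFin.
  have -> : normal_pdf m s x = normal_pdf 0 s (x - m).
    by rewrite !normal_pdfE// normal_fun_center.
  rewrite normal_pdf_tilt// -/k -/m'; congr (_ * _).
  by rewrite !normal_pdfE// /normal_fun opprD addrA addrAC.
rewrite ge0_integralZl//.
- by rewrite integral_normal_pdf mule1.
- by apply/measurable_EFinP; exact: measurable_normal_pdf.
- by move=> x _; rewrite lee_fin normal_pdf_ge0.
- by rewrite lee_fin mulr_ge0 ?expR_ge0// invr_ge0 sqrtr_ge0.
Qed.

(** The fundamental theorem of calculus on the whole line, for a primitive that
    vanishes at infinity. *)
Lemma integral_derive_eq0 (h h' : R -> R) m :
  (forall x : R, is_derive x 1 h (h' x)) -> continuous h' ->
  mu.-integrable setT (EFin \o h') ->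
  h (m + n%:R) @[n --> \oo] --> 0 -> h (m - n%:R) @[n --> \oo] --> 0 ->
  (\int[mu]_x (h' x)%:E = 0)%E.
Proof.
move=> dh ch' ih' hp hm.
pose I n : set R := `[m - n%:R, m + n%:R]%classic.
have ch : continuous h.
  by move=> x; apply/differentiable_continuous/derivable1_diffP; case: (dh x).
have e n : (0 < n)%N -> (\int[mu]_x ((EFin \o h') \_ (I n)) x =
    (h (m + n%:R) - h (m - n%:R))%:E)%E.
  move=> n0; rewrite -integral_mkcond/= EFinB.
  apply: (@continuous_FTC2 _ h' h).
  - by rewrite ltrD2l -subr_gt0 opprK addr_gt0// ltr0n.
  - exact: continuous_subspaceT.
  - split; first by move=> x _; case: (dh x).
    + by apply: cvg_at_right_filter; exact: ch.
    + by apply: cvg_at_left_filter; exact: ch.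
  - by move=> x _; rewrite derive1E; case: (dh x).
have c1 : (\int[mu]_x ((EFin \o h') \_ (I n)) x @[n --> \oo] --> 0)%E.
  suff : (h (m + n%:R) - h (m - n%:R))%:E @[n --> \oo] --> 0%:E.
    apply: cvg_trans; apply: near_eq_cvg; near=> n.
    by rewrite e//; near: n; exact: nbhs_infty_gt.
  apply: cvg_EFin; first exact: nearW.
  by rewrite -[X in _ --> X](subrr 0); apply: cvgB.
have mI n : measurable_fun [set: R] ((EFin \o h') \_ (I n)).
  apply/(measurable_restrictT _ _).1 => //; first exact: measurable_itv.
  apply: measurable_funTS; exact: (measurable_int mu).
have : (\int[mu]_x ((EFin \o h') \_ (I n)) x @[n --> \oo] -->
       \int[mu]_x (EFin \o h') x)%E.
  apply: (@dominated_cvg _ _ _ mu setT measurableT _ _ (abse \o EFin \o h')) => //.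
  - move=> x _; apply: cvg_near_cst.
    near=> n; rewrite patchE mem_set// /I /= in_itv/=.
    have : `|x - m| <= n%:R by near: n; exact: nbhs_infty_ger.
    by rewrite ler_norml; lra.
  - exact: integrable_abse.
  - by move=> n x _; rewrite patchE; case: ifP => //= _; rewrite normr0 lee_fin normr_ge0.
by move=> /(cvg_unique _ c1) => /(_ (@ereal_hausdorff R)) <-.
Unshelve. all: by end_near. Qed.

End gaussian_laplace.

Lemma cvg_invn (R : realType) : (n%:R^-1 : R) @[n --> \oo] --> 0.
Proof. by rewrite -cvg_shiftS; exact: cvg_harmonic. Qed.

Section integration_by_parts.
Context {R : realType}.
Implicit Types (m s u c a : R).
Local Notation mu := (@lebesgue_measure R).

Lemma is_derive_normal_pdf m s (x : R) : s != 0 ->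
  is_derive x 1 (normal_pdf m s) (- ((x - m) / s ^+ 2) * normal_pdf m s x).
Proof.
move=> s0.
have -> : normal_pdf m s =
    (fun y : R => normal_peak s * expR (- (s ^+ 2 *+ 2)^-1 * (y - m) ^+ 2)).
  by apply/funext => y; rewrite normal_pdfE// /normal_fun; congr (_ * expR _); rewrite mulrC mulrN mulNr.
apply: trigger_derive; rewrite /GRing.scale /=.
rewrite -(mulr_natr (s ^+ 2)); set E := expR _.
by field.
Qed.

(** An exponent that is half the one of the Gaussian density dominates quadratic
    growth and leaves half of the decay. *)
Lemma sqr_le_expR s (d : R) : s != 0 ->
  1 + 2 * d ^+ 2 <= (1 + 8 * s ^+ 2) * expR (d ^+ 2 / (4 * s ^+ 2)).
Proof.
move=> s0; have s2 : 0 < s ^+ 2 by rewrite exprn_even_gt0.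
have := expR_ge1Dx (d ^+ 2 / (4 * s ^+ 2)); set E := expR _ => hE.
have d2 : 0 <= d ^+ 2 by exact: sqr_ge0.
have q0 : 0 <= d ^+ 2 / (4 * s ^+ 2) by rewrite divr_ge0// mulr_ge0// ltW.
have e : d ^+ 2 = 4 * s ^+ 2 * (d ^+ 2 / (4 * s ^+ 2)).
  by field.
set q := d ^+ 2 / _ in hE q0 e.
have : s ^+ 2 * q <= s ^+ 2 * (E - 1) by rewrite ler_pM2l//; lra.
lra.
Qed.

Lemma normal_prob_integrable m s K (f : R -> R) : s != 0 ->
  measurable_fun [set: R] f -> (forall x, `|f x| <= K * (1 + 2 * (x - m) ^+ 2)) ->
  (normal_prob m s).-integrable setT (EFin \o f).
Proof.
move=> s0 mf fK; have s2 : 0 < s ^+ 2 by rewrite exprn_even_gt0.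
pose c := 1 / (2 * s ^+ 2).
have cs : 1 - c * s ^+ 2 = 1 / 2 by rewrite /c; field.
pose g x := expR (0 * (x - m) + c / 2 * (x - m) ^+ 2).
have mg : measurable_fun [set: R] g.
  apply: measurableT_comp => //; apply: measurable_funD => //.
    by apply: measurable_funM => //; exact: measurable_funB.
  by apply: measurable_funM => //; apply: measurable_funX; exact: measurable_funB.
have ig : (normal_prob m s).-integrable setT (EFin \o g).
  apply/integrableP; split; first exact/measurable_EFinP.
  under eq_integral do rewrite /= ger0_norm ?expR_ge0//.
  by rewrite /g normal_mgf// ?cs ?ltry//; lra.
have K0 : 0 <= K by have := le_trans (normr_ge0 _) (fK m); rewrite subrr expr0n/=; lra.
apply: (@le_integrable _ _ _ (normal_prob m s) setT measurableT _ (fun x => (K * (1 + 8 * s ^+ 2))%:E * (g x)%:E)%E) => //.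
- exact/measurable_EFinP.
- move=> x _ /=; rewrite lee_fin (le_trans (fK x))// ler_normr; apply/orP; left.
  rewrite -mulrA ler_wpM2l// (le_trans (sqr_le_expR _ s0))//.
  apply: ler_wpM2l; first by rewrite addr_ge0// mulr_ge0// ltW.
  rewrite /g mul0r add0r ler_expR.
  by rewrite mulrC /c le_eqVlt; apply/orP; left; apply/eqP; field.
- exact: integrableZl.
Qed.

(** Integration by parts against the Gaussian density, whose logarithmic
    derivative is affine. *)
Lemma normal_stein m s A (phi phi' : R -> R) : s != 0 ->
  (forall x : R, is_derive x 1 phi (phi' x)) -> continuous phi' ->
  (forall x, `|phi x| <= A * (1 + `|x - m|)) -> (forall x, `|phi' x| <= A) ->
  (\int[normal_prob m s]_x ((x - m) * phi x)%:E =
   \int[normal_prob m s]_x (s ^+ 2 * phi' x)%:E)%E.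
Proof.
move=> s0 dphi cphi' bphi bphi'; have s2 : 0 < s ^+ 2 by rewrite exprn_even_gt0.
have A0 : 0 <= A by exact: le_trans (bphi' 0).
have cphi : continuous phi.
  by move=> x; apply/differentiable_continuous/derivable1_diffP; case: (dphi x).
have mphi : measurable_fun [set: R] phi by exact: continuous_measurable_fun.
have mphi' : measurable_fun [set: R] phi' by exact: continuous_measurable_fun.
have mxm : measurable_fun [set: R] (fun x => x - m) by exact: measurable_funB.
have b1 x : `|(x - m) * phi x| <= A * (1 + 2 * (x - m) ^+ 2).
  rewrite normrM mulrC; apply: (le_trans (ler_wpM2r (normr_ge0 _) (bphi x))).
  rewrite -mulrA; apply: ler_wpM2l => //; rewrite -(real_normK (num_real (x - m))).
  have := sqr_ge0 (`|x - m| - 1); have := normr_ge0 (x - m); nra.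
have b2 x : `|phi' x| <= A * (1 + 2 * (x - m) ^+ 2).
  by rewrite (le_trans (bphi' x))// ler_peMr// lerDl mulr_ge0// sqr_ge0.
have i1 : (normal_prob m s).-integrable setT (EFin \o (fun x => (x - m) * phi x)).
  by apply: (normal_prob_integrable s0 _ b1); exact: measurable_funM.
have i2 : (normal_prob m s).-integrable setT (EFin \o (fun x => s ^+ 2 * phi' x)).
  rewrite /comp; under eq_fun do rewrite EFinM.
  apply: integrableZl => //; exact: (normal_prob_integrable s0 _ b2).
have p0 x : 0 <= normal_pdf m s x by exact: normal_pdf_ge0.
pose h x := phi x * normal_pdf m s x.
pose h' x := (s ^+ 2)^-1 * ((s ^+ 2 * phi' x - (x - m) * phi x) * normal_pdf m s x).
have mq : measurable_fun [set: R] (fun x => s ^+ 2 * phi' x - (x - m) * phi x).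
  by apply: measurable_funB; apply: measurable_funM.
have iq : (normal_prob m s).-integrable setT
    (EFin \o (fun x => s ^+ 2 * phi' x - (x - m) * phi x)).
  by rewrite /comp; under eq_fun do rewrite EFinB; exact: integrableB.
have iqp : mu.-integrable setT
    (fun x => ((s ^+ 2 * phi' x - (x - m) * phi x) * normal_pdf m s x)%:E).
  apply/integrableP; split.
    by apply/measurable_EFinP; apply: measurable_funM => //; exact: measurable_normal_pdf.
  have e x : (`|((s ^+ 2 * phi' x - (x - m) * phi x) * normal_pdf m s x)%:E| =
      `|(s ^+ 2 * phi' x - (x - m) * phi x)%:E| * (normal_pdf m s x)%:E)%E.
    by rewrite EFinM abseM (@gee0_abs _ (normal_pdf m s x)%:E)// lee_fin.
  under eq_integral do rewrite e.
  rewrite -ge0_integral_normal_prob//; first by case/integrableP : iq.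
  by apply: measurableT_comp => //; exact/measurable_EFinP.
(* the boundary terms, at the right end for [e = 1] and at the left for [e = -1] *)
have hn (e : R) n : `|e| = 1 -> (0 < n)%N ->
    `|h (m + e * n%:R)| <= normal_peak s * A * (1 + 8 * s ^+ 2) / n%:R.
  move=> e1 n0; rewrite /h normrM (ger0_norm (p0 _)) normal_pdfE// /normal_fun.
  have en : m + e * n%:R - m = e * n%:R by lra.
  have := bphi (m + e * n%:R); rewrite en normrM e1 mul1r normr_nat => bn.
  have e2 : e ^+ 2 = 1 by rewrite -real_normK ?num_real// e1 expr1n.
  rewrite exprMn e2 mul1r.
  have N0 : (0 : R) < n%:R by rewrite ltr0n.
  have q : 1 + 2 * n%:R ^+ 2 <= (1 + 8 * s ^+ 2) * expR (n%:R ^+ 2 / (s ^+ 2 *+ 2)).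
    apply: (le_trans (sqr_le_expR _ s0)); apply: ler_wpM2l.
      by rewrite addr_ge0// mulr_ge0// ltW.
    rewrite ler_expR; apply: ler_wpM2l; first exact: sqr_ge0.
    by rewrite -mulr_natr lef_pV2 ?posrE; lra.
  rewrite mulNr expRN; move: q; set E := expR _ => q; have E0 : 0 < E by exact: expR_gt0.
  rewrite ler_pdivlMr//.
  have -> : `|phi (m + e * n%:R)| * (normal_peak s / E) * n%:R =
      normal_peak s * ((`|phi (m + e * n%:R)| * n%:R) / E) by ring.
  rewrite -!mulrA; apply: ler_wpM2l; first exact: normal_peak_ge0.
  rewrite mulrA ler_pdivrMr// -mulrA.
  apply: (@le_trans _ _ (A * (1 + n%:R) * n%:R)); first by rewrite ler_pM2r.
  rewrite -mulrA; apply: ler_wpM2l => //; apply: le_trans q.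
  have := sqr_ge0 (n%:R - 1 : R); nra.
have hlim (e : R) : `|e| = 1 -> h (m + e * n%:R) @[n --> \oo] --> 0.
  move=> e1; apply: norm_cvg0; apply: (@squeeze_cvgr _ _ _ _ (cst 0)
    (fun n => normal_peak s * A * (1 + 8 * s ^+ 2) / n%:R)).
  - by near=> n; rewrite normr_ge0 hn//; near: n; exact: nbhs_infty_gt.
  - exact: cvg_cst.
  - rewrite -[X in _ --> X](mulr0 (normal_peak s * A * (1 + 8 * s ^+ 2))).
    apply: cvgM; [exact: cvg_cst | exact: cvg_invn].
have H0 : (\int[mu]_x (h' x)%:E = 0)%E.
  apply: (@integral_derive_eq0 _ h h' m).
  - move=> x; have := is_derive_normal_pdf m x s0 => dp.
    rewrite /h /h'; apply: is_derive_eq; rewrite /GRing.scale /=.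
    by field.
  - move=> x; rewrite /h'; apply: cvgM; first exact: cvg_cst.
    apply: cvgM; last exact: continuous_normal_pdf.
    apply: (@cvgB _ R^o).
      by apply: cvgM; [exact: cvg_cst | exact: cphi'].
    apply: cvgM; last exact: cphi.
    by apply: (@cvgB _ R^o); [exact: cvg_id | exact: cvg_cst].
  - rewrite /h' /comp.
    under eq_fun do rewrite EFinM.
    by apply: integrableZl.
  - by have := hlim 1 (normr1 _); under eq_fun do rewrite mul1r.
  - have := hlim (-1); rewrite normrN normr1 => /(_ erefl).
    by under eq_fun do rewrite mulN1r.

have : (\int[normal_prob m s]_x (s ^+ 2 * phi' x - (x - m) * phi x)%:E = 0)%E.
  rewrite integral_normal_prob//.
  move: H0; rewrite /h'; under eq_integral do rewrite EFinM.
  rewrite integralZl// => /eqP; rewrite mule_eq0 eqe invr_eq0 gt_eqF//=.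
  by move=> /eqP.
under eq_integral do rewrite EFinB.
rewrite integralB// => /eqP; rewrite sube_eq ?add0e; last 2 first.
- by rewrite integrable_fin_num.
- by rewrite fin_num_adde_defl// integrable_fin_num.
by move=> /eqP ->.
Unshelve. all: by end_near. Qed.

End integration_by_parts.

Section gaussian_integrals.
Context {R : realType}.
Implicit Types (m s u c a : R).

Lemma normal_mean m s : s != 0 ->
  (\int[normal_prob m s]_x (x - m)%:E = 0)%E.
Proof.
move=> s0; have := @normal_stein R m s 1 (cst 1) (cst 0) s0.
under eq_integral do rewrite /= mulr1.
move=> ->//=.
- by under eq_integral do rewrite mulr0; rewrite integral0.
- by move=> x; exact: cst_continuous.
- by move=> x; rewrite normr1 mul1r lerDl.
- by move=> x; rewrite normr0.
Qed.

Lemma normal_variance m s : s != 0 ->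
  (\int[normal_prob m s]_x ((x - m) ^+ 2)%:E = (s ^+ 2)%:E)%E.
Proof.
have d1 (x : R) : is_derive x 1 (fun x => x - m) (cst 1 x).
  by apply: is_derive_eq; rewrite subr0.
move=> s0; have := @normal_stein R m s 1 _ (cst 1) s0 d1.
under eq_integral do rewrite -expr2.
move=> ->//=.
- by under eq_integral do rewrite mulr1; rewrite integral_cst//= probability_setT mule1.
- by move=> x; exact: cst_continuous.
- by move=> x; rewrite mul1r lerDr.
- by move=> x; rewrite normr1.
Qed.

Let F s u := (\int[normal_prob 0 s]_x cos (u * x))%R.

Let mcos u : measurable_fun [set: R] (fun x : R => cos (u * x)).
Proof.
apply: measurableT_comp; first by apply: continuous_measurable_fun; exact: continuous_cos.
exact: measurable_funM.
Qed.

Let icos s u : s != 0 ->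
  (normal_prob 0 s).-integrable setT (EFin \o (fun x : R => cos (u * x))).
Proof.
move=> s0; apply: (@normal_prob_integrable _ _ _ 1) => // x.
by rewrite mul1r (le_trans (cos_max _))// lerDl mulr_ge0// sqr_ge0.
Qed.

(** Stein's identity turns the derivative of the characteristic function into
    a multiple of itself. *)
Let derF s u : s != 0 -> is_derive u 1 (F s) (- (s ^+ 2 * u * F s u)).
Proof.
move=> s0.
have d1 (x y : R) : is_derive x 1 (fun x => cos (x * y)) (- (y * sin (x * y))).
  by apply: trigger_derive; rewrite /GRing.scale/=; ring.
have iG : (normal_prob 0 s).-integrable setT (EFin \o (fun x : R => `|x|)).
  apply: (@normal_prob_integrable _ _ _ 1) => //.
  move=> x; rewrite normr_id subr0 mul1r -(real_normK (num_real x)).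
  have := sqr_ge0 (`|x| - 1); have := normr_ge0 x; nra.
have Iu : `]u - 1, u + 1[%classic u by rewrite /= in_itv/=; lra.
have d1E x y : partial1of2 (fun x y : R => cos (x * y)) x y = - (y * sin (x * y)).
  by rewrite /partial1of2 derive1E; have [_ ->] := d1 x y.
have Gub : forall x y : R, `]u - 1, u + 1[%classic x -> setT y ->
    `|partial1of2 (fun x y : R => cos (x * y)) x y| <= `|y|.
  by move=> x y _ _; rewrite d1E normrN normrM ler_piMr// sin_max.
have intf (x : R) : `]u - 1, u + 1[%classic x ->
   (normal_prob 0 s).-integrable setT (EFin \o (fun y : R => cos (x * y))).
  by move=> _; exact: icos.
have df (x y : R) : `]u - 1, u + 1[%classic x -> setT y ->
    derivable (fun x : R => cos (x * y)) x 1.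
  by move=> _ _; case: (d1 x y).
have dF := derivable_under_integral measurableT Iu intf df (fun=> normr_ge0 _) iG Gub.
have eF := differentiation_under_integral measurableT Iu intf df (fun=> normr_ge0 _) iG Gub.
apply: DeriveDef; first exact: dF.
rewrite -derive1E [LHS]eF /Rintegral /=.
under eq_integral do rewrite d1E -mulN1r EFinM.
have isin : (normal_prob 0 s).-integrable setT (fun y => (y * sin (u * y))%:E).
  apply: (@normal_prob_integrable _ _ _ 1) => //.
    apply: measurable_funM => //; apply: measurableT_comp; last exact: measurable_funM.
    by apply: continuous_measurable_fun; exact: continuous_sin.
  move=> x; rewrite mul1r subr0 normrM (le_trans (ler_piMr _ (sin_max _)))//.
  rewrite -(real_normK (num_real x)).
  have := sqr_ge0 (`|x| - 1); have := normr_ge0 x; nra.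
rewrite integralZl//.
have dphi (x : R) : is_derive x 1 (fun x => sin (u * x)) (u * cos (u * x)).
  by apply: trigger_derive; rewrite /GRing.scale/=; ring.
under eq_integral do rewrite -[X in (X * _)%:E]subr0.
rewrite (@normal_stein R 0 s (1 + `|u|) _ _ s0 dphi).
- under eq_integral do rewrite mulrA EFinM.
  rewrite integralZl//; last exact: icos.
  have /fineK : (\int[normal_prob 0 s]_x (cos (u * x))%:E)%E \is a fin_num.
    by rewrite integrable_fin_num//; exact: icos.
  by rewrite -/(Rintegral _ _ _) -/(F s u) => <-; rewrite -!EFinM/=; ring.
- move=> x; apply: cvgM; first exact: cvg_cst.
  apply: continuous_comp; last exact: continuous_cos.
  by apply: cvgM; [exact: cvg_cst | exact: cvg_id].
- move=> x; rewrite (le_trans (sin_max _))//.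
  by have := normr_ge0 (x - 0); have := normr_ge0 u; nra.
- move=> x; rewrite normrM (le_trans (ler_piMr _ (cos_max _)))// lerDr//.
Qed.

(** The linear differential equation of the characteristic function has one
    solution with value one at the origin. *)
Lemma normal_cos s u : s != 0 ->
  (\int[normal_prob 0 s]_x (cos (u * x))%:E = (expR (- (s ^+ 2 * u ^+ 2 / 2)))%:E)%E.
Proof.
move=> s0; pose g v := F s v * expR (s ^+ 2 * v ^+ 2 / 2).
have dg (v : R) : is_derive v 1 g 0.
  have dF := @derF s v s0; apply: trigger_derive.
  by rewrite /GRing.scale/=; field.
have := @is_derive_0_is_cst _ g u 0 dg.
rewrite /g expr0n/= mulr0 mul0r expR0 mulr1.
have -> : F s 0 = 1.
  rewrite /F; under eq_Rintegral do rewrite mul0r cos0.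
  rewrite Rintegral_cst// mul1r -[RHS]/(fine 1%E); congr fine.
  exact: (probability_setT (normal_prob 0 s)).
move=> Fu; have iu := icos u s0.
rewrite -[LHS]fineK ?integrable_fin_num//; congr EFin.
rewrite -[LHS]/(F s u) expRN.
have E0 : expR (s ^+ 2 * u ^+ 2 / 2) != 0 by rewrite gt_eqF// expR_gt0.
by apply: (mulIf E0); rewrite Fu mulVf.
Qed.

End gaussian_integrals.

Section gaussian_transfer.
Context {R : realType} {d : measure_display} {T : measurableType d}.
Variable P : probability T R.

Lemma bounded_integrable (f : T -> R) (K : R) : measurable_fun setT f ->
  (forall w, `|f w| <= K) -> P.-integrable setT (EFin \o f).
Proof.
move=> mf fK; apply: (@le_integrable _ _ _ P setT measurableT _ (cst K%:E)) => //.
- exact/measurable_EFinP.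
- by move=> w _ /=; rewrite lee_fin (le_trans (fK w))// ler_norm.
- by apply: finite_measure_integrable_cst.
Qed.

Variables (Y : T -> R) (mY : measurable_fun setT Y).
Hypothesis gY : gaussian P Y.

Let ge0E (m s : R) (f : R -> R) : (forall V : set R, measurable V ->
    pushforward P Y V = if s == 0 then \d_m V else normal_prob m s V) ->
  measurable_fun setT f -> (forall x, 0 <= f x) ->
  (\int[P]_w (f (Y w))%:E =
   if s == 0%R then (f m)%:E else \int[normal_prob m s]_x (f x)%:E)%E.
Proof.
move=> law mf f0.
rewrite -[LHS](@ge0_integral_pushforward _ _ T (measurableTypeR R) R Y mY P setT (EFin \o f))//; last 2 first.
- exact/measurable_EFinP.
- by move=> y _; rewrite /= lee_fin.
have [s0|s0] := eqVneq s 0.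
- rewrite (@eq_measure_integral _ _ _ _ (\d_(m : measurableTypeR R) : {measure set (measurableTypeR R) -> \bar R})).
    by rewrite integral_dirac//=; [rewrite diracE in_setT mul1e | exact/measurable_EFinP].
  by move=> A mA _; have := law A mA; rewrite s0 eqxx.
- rewrite (@eq_measure_integral _ _ _ _ (normal_prob m s))// => A mA _.
  by have := law A mA; rewrite (negbTE s0).
Qed.

(** A degenerate law, with [s = 0], obeys the same three formulas.  In both cases
    the law is tested on nonnegative functions only. *)
Lemma gaussian_centered : (\int[P]_w (Y w)%:E = 0)%E ->
  exists s : R, [/\ (\int[P]_w (Y w ^+ 2)%:E = (s ^+ 2)%:E)%E,
    (\int[P]_w (expR (Y w))%:E = (expR (s ^+ 2 / 2))%:E)%E &
    (\int[P]_w (cos (Y w))%:E = (expR (- (s ^+ 2 / 2)))%:E)%E].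
Proof.
have [m [s law]] := gY => EY0.
have mcos : measurable_fun [set: R] (@cos R).
  by apply: continuous_measurable_fun; exact: continuous_cos.
have mexp : measurable_fun [set: R] (@expR R).
  by apply: continuous_measurable_fun; exact: continuous_expR.
have cos1 (x : R) : 0 <= 1 + cos x.
  by have := cos_max x; rewrite ler_norml; lra.
have icosY : P.-integrable setT (EFin \o (fun w => cos (Y w))).
  apply: (@bounded_integrable _ 1); first exact: measurableT_comp.
  by move=> w; exact: cos_max.
(* shifting the cosine makes it nonnegative *)
have EcosY : (\int[P]_w (1 + cos (Y w))%:E = 1 + \int[P]_w (cos (Y w))%:E)%E.
  under eq_integral do rewrite EFinD.
  rewrite integralD//; last exact: finite_measure_integrable_cst.
  by rewrite integral_cst//= probability_setT mule1.
have mid : measurable_fun [set: measurableTypeR R] (EFin \o @id R).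
  exact/measurable_EFinP.
have m0 : m = 0.
  have iY : P.-integrable setT (EFin \o Y).
    apply/integrableP; split; first exact/measurable_EFinP.
    rewrite [X in (X < _)%E](_ : _ = \int[P]_w (`|Y w|)%:E)%E//.
    rewrite (@ge0E m s (fun x => `|x|) law)//; case: ifPn => [_|s0]; first by rewrite ltry.
    have : (normal_prob m s).-integrable setT (EFin \o (@id R)).
      apply: (@normal_prob_integrable _ _ _ (1 + `|m|)) => // x.
      rewrite -(real_normK (num_real (x - m))) /=.
      have : `|x| <= `|x - m| + `|m| by rewrite -[in leLHS](subrK m x) ler_normD.
      have := sqr_ge0 (`|x - m| - 1); have := normr_ge0 (x - m).
      have := normr_ge0 m; nra.
    by move=> /integrableP[].
  have := @integral_pushforward _ _ T (measurableTypeR R) R Y mY P setT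
    (EFin \o @id R) mid iY measurableT.
  rewrite [RHS]EY0 => E0.
  have [s0|s0] := eqVneq s 0.
    move: E0; rewrite (@eq_measure_integral _ _ _ _ (\d_(m : measurableTypeR R) : {measure set (measurableTypeR R) -> \bar R})).
      by rewrite integral_dirac//= ?diracE ?in_setT ?mul1e; case.
    by move=> A mA _; have := law A mA; rewrite s0 eqxx.
  move: E0; rewrite (@eq_measure_integral _ _ _ _ (normal_prob m s)); last first.
    by move=> A mA _; have := law A mA; rewrite (negbTE s0).
  have i1 : (normal_prob m s).-integrable setT (EFin \o (fun x : R => x - m)).
    apply: (@normal_prob_integrable _ _ _ 1) => //.
      exact: measurable_funB.
    move=> x; rewrite mul1r -(real_normK (num_real (x - m))).
    have := sqr_ge0 (`|x - m| - 1); have := normr_ge0 (x - m); nra.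
  under eq_integral do rewrite /= -[X in X%:E](subrK m) EFinD.
  rewrite integralD//; last exact: finite_measure_integrable_cst.
  rewrite normal_mean// add0e integral_cst//.
  by rewrite [X in (_ * X)%E](probability_setT (normal_prob m s)) mule1; case.
exists s; have [s0|s0] := eqVneq s 0.
  have ez (f : R -> R) : measurable_fun setT f -> (forall x : R, 0 <= f x) ->
      (\int[P]_w (f (Y w))%:E = (f 0)%:E)%E.
    by move=> mf f0; rewrite (@ge0E m s f law)// s0 eqxx m0.
  split.
  - by rewrite (ez (fun x => x ^+ 2))// ?s0// => x; exact: sqr_ge0.
  - by rewrite (ez expR)// ?s0 ?expR0 ?expr0n ?mul0r ?expR0// => x; exact: expR_ge0.
  - have := ez (fun x => 1 + cos x) (measurable_funD _ mcos) cos1.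
    rewrite EcosY cos0 s0 expr0n/= mul0r oppr0 expR0 EFinD.
    by move=> /(_ (measurable_cst _)) /(congr1 (fun x => x - 1%:E)%E); rewrite ![(1%:E + _)%E]addeC !addeK.
have ez (f : R -> R) : measurable_fun setT f -> (forall x : R, 0 <= f x) ->
    (\int[P]_w (f (Y w))%:E = \int[normal_prob 0 s]_x (f x)%:E)%E.
  by move=> mf f0; rewrite (@ge0E m s f law)// (negbTE s0) m0.
split.
- rewrite (ez (fun x => x ^+ 2))//; last by move=> x; exact: sqr_ge0.
  by rewrite -(normal_variance 0 s0); apply: eq_integral => x _; rewrite subr0.
- rewrite (ez expR)//.
  have := @normal_mgf R 0 s 1 0 s0; rewrite mul0r subr0 => /(_ ltr01).
  rewrite sqrtr1 invr1 mul1r expr1n mul1r mulr1 => <-.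
  by apply: eq_integral => x _; rewrite subr0 mul1r !mul0r addr0.
- have := ez (fun x => 1 + cos x) (measurable_funD _ mcos) cos1.
  move=> /(_ (measurable_cst _)); rewrite EcosY.
  under [X in _ = X -> _]eq_integral do rewrite EFinD -[X in cos X]mul1r.
  rewrite integralD//; last 2 first.
  + exact: finite_measure_integrable_cst.
  + apply: (@normal_prob_integrable _ _ _ 1) => //.
      by apply: measurableT_comp => //; exact: measurable_funM.
    by move=> x; rewrite (le_trans (cos_max _))// mul1r lerDl mulr_ge0// sqr_ge0.
  rewrite normal_cos// integral_cst//.
  rewrite [X in (_ * X)%E](probability_setT (normal_prob 0 s)) mule1 expr1n mulr1.
  by move=> /(congr1 (fun x => x - 1%:E)%E); rewrite ![(1%:E + _)%E]addeC !addeK.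
Qed.

End gaussian_transfer.

(** * Sums of squares of a Gaussian family *)

Section quadratic_forms.
Context {R : realType} {V : lmodType R}.
Implicit Types (b : V -> V -> R) (u v w : V) (c L : R).

Definition symmetric_form b :=
  (forall u v, b u v = b v u) /\
  (forall a u v w, b (a *: u + v) w = a * b u w + b v w).

Lemma form_expand b u v t : symmetric_form b ->
  b (u + t *: v) (u + t *: v) = b u u + 2 * t * b u v + t ^+ 2 * b v v.
Proof.
move=> [bC bL]; rewrite (addrC u) bL (bC v) (bC u) !bL (bC v u); ring.
Qed.

Variables (b : V -> V -> R) (e : nat -> V) (c : R).

(** The covariance form of a Gaussian family under the density
    proportional to [exp (c / 2 * \sum_(i < j) Y_(e i) ^+ 2)]. *)
Fixpoint tilted_form (j : nat) : V -> V -> R :=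
  if j is j'.+1 then fun u v =>
    tilted_form j' u v +
    c / (1 - c * tilted_form j' (e j') (e j')) *
      (tilted_form j' u (e j') * tilted_form j' v (e j'))
  else b.

(** The factor by which one more tilting step multiplies the precision of the
    next variable; it has to stay positive for the next integral to be finite. *)
Definition pivot j := 1 - c * tilted_form j (e j) (e j).

Lemma symmetric_tilted_form j : symmetric_form b -> symmetric_form (tilted_form j).
Proof.
move=> sb; elim: j => //= j [jC jL]; split=> [u v|a u v w].
  by rewrite jC; congr (_ + _ * _); rewrite mulrC.
by rewrite !jL; ring.
Qed.

Hypothesis sb : symmetric_form b.

(** Tilting is partial optimisation: each step completes the square in one more
    direction, at the price of a penalty on the coefficient.  This compares the
    tilted form with [b] without inverting any matrix. *)
Lemma tilted_form_attained j u : c != 0 -> (forall i, (i < j)%N -> pivot i != 0) ->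
  exists tau : nat -> R, tilted_form j u u =
    b (u + \sum_(i < j) tau i *: e i) (u + \sum_(i < j) tau i *: e i)
    - c^-1 * \sum_(i < j) tau i ^+ 2.
Proof.
move=> c0; elim: j u => [u _|j IH u pj] /=.
  by exists (cst 0); rewrite !big_ord0 addr0 mulr0 subr0.
have pj' : forall i, (i < j)%N -> pivot i != 0 by move=> i ij; apply: pj; exact: ltnW.
have := pj j (ltnSn j); rewrite /pivot; set s := tilted_form j (e j) (e j) => s0.
pose a := tilted_form j u (e j); pose t := c * a / (1 - c * s).
have [tau Htau] := IH (u + t *: e j) pj'.
exists (fun i => if i == j then t else tau i).
have eS (F : nat -> V) (G : nat -> R -> V) :
   \sum_(i < j.+1) G i (if (i : nat) == j then t else tau i) =
   \sum_(i < j) G i (tau i) + G j t.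
  rewrite big_ord_recr/= eqxx; congr (_ + _); apply: eq_bigr => i _.
  by rewrite ltn_eqF.
have eR : \sum_(i < j.+1) (if (i : nat) == j then t else tau i) ^+ 2 =
   \sum_(i < j) (tau i) ^+ 2 + t ^+ 2.
  rewrite big_ord_recr/= eqxx; congr (_ + _); apply: eq_bigr => i _.
  by rewrite ltn_eqF.
rewrite (eS (fun=> 0) (fun i r => r *: e i)) eR.
rewrite (addrC _ (t *: e j)) addrA mulrDr opprD addrA -Htau.
rewrite form_expand; last exact: symmetric_tilted_form.
rewrite -/a -/s /t.
by field; rewrite s0 c0.
Qed.

Variables (L : R) (N : nat).
Hypothesis L0 : 0 < L.
Hypothesis b_ge0 : forall u, 0 <= b u u.
Hypothesis b_le : forall (j : nat) (tau : nat -> R), (j <= N)%N ->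
  b (\sum_(i < j) tau i *: e i) (\sum_(i < j) tau i *: e i) <=
  L * \sum_(i < j) tau i ^+ 2.
Hypothesis b_diag : forall i, (i < N)%N -> b (e i) (e i) <= L.
Hypothesis c0 : c != 0.
Hypothesis cL : 2 * c * L < 1.

Let D0 : 0 < 1 - c * L.
Proof.
have [|cl0] := leP (c * L) 0; first by lra.
by move: cL; rewrite -mulrA; lra.
Qed.

(** The penalty outweighs the form on the span of the directions, by the norm
    bound [L], so only the vector itself contributes, amplified by
    [1 / (1 - c * L)]. *)
Lemma tilted_form_le j u : (j <= N)%N -> (forall i, (i < j)%N -> pivot i != 0) ->
  c * tilted_form j u u <= c * b u u / (1 - c * L).
Proof.
move=> jN pj; have [tau ->] := tilted_form_attained u c0 pj.
have := b_le tau jN.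
set t := \sum_(i < j) _ *: _; set S := \sum_(i < j) _ => btS.
rewrite ler_pdivlMr//.
rewrite [c * (_ - _)](_ : _ = c * b (u + t) (u + t) - S); last by field.
have -> : u + t = u + 1 *: t by rewrite scale1r.
rewrite form_expand//.
(* up to the defect in the norm bound, the claim is the nonnegativity of [b] at
   [c * L *: u - (1 - c * L) *: t] *)
have : 0 <= b (u + (- (1 - c * L) / (c * L)) *: t) (u + (- (1 - c * L) / (c * L)) *: t) by [].
rewrite form_expand// => h.
have cL0 : c * L != 0 by rewrite mulf_neq0// gt_eqF.
have {}h : 0 <= (c * L) ^+ 2 * b u u - 2 * (1 - c * L) * (c * L) * b u t
    + (1 - c * L) ^+ 2 * b t t.
  have := mulr_ge0 (sqr_ge0 (c * L)) h.
  rewrite [X in 0 <= X -> _](_ : _ = (c * L) ^+ 2 * b u u - 2 * (1 - c * L) * (c * L) * b u t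
    + (1 - c * L) ^+ 2 * b t t)//.
  by field; apply/andP; split; rewrite ?c0 ?gt_eqF.
rewrite -subr_ge0 -(pmulr_rge0 _ L0).
have : 0 <= (1 - c * L) * (L * S - b t t).
  by apply: mulr_ge0; [exact: ltW | rewrite subr_ge0].
move: h; set x := b u u; set y := b u t; set z := b t t => h hS.
have := addr_ge0 h hS; rewrite [X in 0 <= X -> _](_ : _ =
  L * (c * x - (c * (x + 2 * 1 * y + 1 ^+ 2 * z) - S) * (1 - c * L)))//.
by ring.
Qed.

(** The previous bound gives [pivot j >= 1 - c * L / (1 - c * L)], which is
    positive because [2 * c * L < 1]; the induction is needed since that bound
    itself divides by the earlier pivots. *)
Lemma pivot_gt0 j : (j < N)%N -> 0 < pivot j.
Proof.
elim/ltn_ind: j => j IH jN.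
have pj i : (i < j)%N -> pivot i != 0.
  by move=> ij; rewrite gt_eqF// IH// (ltn_trans ij).
have := tilted_form_le (e j) (ltnW jN) pj; rewrite ler_pdivlMr// /pivot.
set s := tilted_form _ _ _ => h.
rewrite -(pmulr_lgt0 _ D0) mulrBl mul1r.
have bj := b_diag jN; have b0 := b_ge0 (e j); have d0 := D0.
have [c_gt0|c_le0] := ltP 0 c; last first.
  have : c * b (e j) (e j) <= 0 by rewrite mulr_le0_ge0.
  lra.
have : c * b (e j) (e j) <= c * L by rewrite ler_pM2l.
move: cL; rewrite -mulrA; lra.
Qed.

(** The mass of the tilted measure, a product of one-dimensional Gaussian
    integrals; it plays the role of the determinant [\det (1 - c * b)] to the
    power minus one half. *)
Definition tilt_mass j := \prod_(i < j) (Num.sqrt (pivot i))^-1.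

(** Each inverse pivot is at most [1 + c * b (e i) (e i) / (1 - 2 * c * L)], and
    the product of these is bounded by the exponential of the sum. *)
Lemma tilt_mass_le :
  tilt_mass N <= expR (c * \sum_(i < N) b (e i) (e i) / (2 * (1 - 2 * c * L))).
Proof.
rewrite mulr_sumr expR_sum.
rewrite /tilt_mass; apply: ler_prod => i _; rewrite invr_ge0 sqrtr_ge0/=.
have p0 := pivot_gt0 (ltn_ord i).
rewrite -sqrtrV ?(ltW p0)//.
set z := c * (b (e i) (e i) / _).
have -> : expR z = Num.sqrt (expR z ^+ 2) by rewrite sqrtr_sqr ger0_norm// expR_ge0.
apply: ler_wsqrtr; rewrite -expRM_natl.
apply: (le_trans _ (expR_ge1Dx _)).
have pj k : (k < i)%N -> pivot k != 0.
  by move=> ki; rewrite gt_eqF// pivot_gt0// (ltn_trans ki).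
have := tilted_form_le (e i) (ltnW (ltn_ord i)) pj.
have q0 : 0 < 1 - 2 * c * L by rewrite subr_gt0.
rewrite ler_pdivlMr// -[c * tilted_form _ _ _](subKr 1) -/(pivot i).
set p := pivot i in p0 *.
have bi := b_diag (ltn_ord i); have b0 := b_ge0 (e i).
rewrite /z; move: bi b0; set x := b (e i) (e i) => xL x0 h.
rewrite [1 + _](_ : _ = (1 - 2 * c * L + c * x) / (1 - 2 * c * L)); last first.
  by field; rewrite gt_eqF.
rewrite ler_pdivlMr// mulrC ler_pdivrMr//.
have d0 := D0; have qX : 0 <= 1 - 2 * c * L + c * x.
  have [c_ge0|c_lt0] := leP 0 c; first by rewrite addr_ge0 ?mulr_ge0// ltW.
  have : c * L <= c * x by rewrite ler_nM2l.
  by move: d0; rewrite -mulrA; lra.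
have k : 0 <= c ^+ 2 * (x * (L - x)).
  by rewrite mulr_ge0 ?sqr_ge0// mulr_ge0// subr_ge0.
rewrite -subr_ge0 -(pmulr_rge0 _ d0).
have := mulr_ge0 qX (_ : 0 <= c * x - (1 - p) * (1 - c * L)).
rewrite subr_ge0 => /(_ h) h'; have := addr_ge0 h' k.
by rewrite [X in 0 <= X -> _](_ : _ =
  (1 - c * L) * ((1 - 2 * c * L + c * x) * p - (1 - 2 * c * L)))//; ring.
Qed.

End quadratic_forms.

Section gaussian_family.
Context {R : realType} {d : measure_display} {T : measurableType d}.
Variables (P : probability T R) (V : lmodType R) (Y : V -> T -> R).
Hypothesis mY : forall u, measurable_fun setT (Y u).
Hypothesis Y_lin : forall a u v w, Y (a *: u + v) w = a * Y u w + Y v w.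
Variables (b : V -> V -> R) (e : nat -> V) (c : R).
Hypothesis sb : symmetric_form b.

Local Notation gamma := (normal_prob (0 : R) 1).
Local Notation q := (tilted_form b e c).
Local Notation K := (tilt_mass b e c).
Local Notation F j := (fun w => \sum_(i < j) Y (e i) w ^+ 2).

Let mF j : measurable_fun setT (F j).
Proof.
by apply: measurable_sum => i; apply: measurable_funX; exact: mY.
Qed.

Let Y0 w : Y 0 w = 0.
Proof. by have := Y_lin (-1) 0 0 w; rewrite scaler0 addr0; lra. Qed.

Let YD a u v w : Y (u + a *: v) w = Y u w + a * Y v w.
Proof. by rewrite addrC Y_lin addrC. Qed.

Let Ksuc j : K j.+1 = K j * (Num.sqrt (pivot b e c j))^-1.
Proof. by rewrite /tilt_mass big_ord_recr. Qed.

Let qsuc j u : q j.+1 u u = q j u u + c / pivot b e c j * q j u (e j) ^+ 2.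
Proof. by rewrite /= -expr2. Qed.

Let mgf01 (x y : R) : 0 < 1 - y ->
  (\int[gamma]_t (expR (x * t + y / 2 * t ^+ 2))%:E =
   ((Num.sqrt (1 - y))^-1 * expR (x ^+ 2 / (2 * (1 - y))))%:E)%E.
Proof.
move=> y1; have := @normal_mgf R 0 1 x y (oner_neq0 _).
rewrite expr1n !mulr1 => /(_ y1) <-.
by apply: eq_integral => t _; rewrite subr0.
Qed.

Variable N : nat.
Hypothesis pivot0 : forall j, (j < N)%N -> 0 < pivot b e c j.

Let mexpR : measurable_fun setT (@expR R).
Proof. by apply: continuous_measurable_fun; exact: continuous_expR. Qed.

Let mcosR : measurable_fun setT (@cos R).
Proof. by apply: continuous_measurable_fun; exact: continuous_cos. Qed.

Let mfst (f : T -> R) : measurable_fun setT f ->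
  measurable_fun setT (fun z : T * measurableTypeR R => f z.1).
Proof. by move=> mf; apply: measurableT_comp. Qed.

Let msnd : measurable_fun setT (fun z : T * measurableTypeR R => z.2 : R).
Proof. exact: measurable_snd. Qed.

(** Upper tail: a square in the exponent is the Laplace transform of an
    independent Gaussian, which shifts the linear term. *)
Lemma integral_expR_squares (c_gt0 : 0 < c)
  (lap : forall u, (\int[P]_w (expR (Y u w))%:E = (expR (b u u / 2))%:E)%E) j u :
  (j <= N)%N ->
  (\int[P]_w (expR (c / 2 * F j w + Y u w))%:E = (K j * expR (q j u u / 2))%:E)%E.
Proof.
elim: j u => [|j IH] u jN.
  rewrite /tilt_mass big_ord0 mul1r -lap.
  by apply: eq_integral => w _; rewrite big_ord0 mulr0 add0r.
have p0 := pivot0 jN.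
set g := Y (e j); set r := Num.sqrt c; have r2 : r ^+ 2 = c by rewrite sqr_sqrtr// ltW.
pose f (z : T * measurableTypeR R) := (expR (c / 2 * F j z.1 + Y u z.1 + r * z.2 * g z.1))%:E.
have mf : measurable_fun setT f.
  apply/measurable_EFinP; apply: measurableT_comp => //; apply: measurable_funD.
    apply: measurable_funD; last by exact: (mfst (mY _)).
    by apply: measurable_funM => //; exact: (mfst (mF j)).
  apply: measurable_funM; last by exact: (mfst (mY _)).
  by apply: measurable_funM => //; exact: msnd.
transitivity (\int[P]_w \int[gamma]_t f (w, t))%E.
  apply: eq_integral => w _; rewrite /f /=.
  under eq_integral do rewrite expRD EFinM.
  rewrite ge0_integralZl//; last first.
    apply/measurable_EFinP; apply: measurableT_comp => //.
    by apply: measurable_funM => //; exact: measurable_funM.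
  rewrite big_ord_recr/= mulrDr -/g addrAC expRD EFinM; congr (_ * _)%E.
  have := @mgf01 (r * g w) 0; rewrite subr0 sqrtr1 invr1 mul1r mulr1 => /(_ ltr01).
  rewrite exprMn r2 mulrAC => <-.
  by apply: eq_integral => t _; rewrite !mul0r addr0 mulrAC.
rewrite fubini_tonelli//; last by move=> z; rewrite lee_fin expR_ge0.
have -> : (\int[gamma]_t \int[P]_w f (w, t) =
    \int[gamma]_t ((K j * expR (q j u u / 2))%:E *
      (expR (r * q j u (e j) * t + (1 - pivot b e c j) / 2 * t ^+ 2))%:E))%E.
  apply: eq_integral => t _; rewrite /f /=.
  under eq_integral do rewrite -addrA -YD.
  rewrite IH ?(ltnW jN)// form_expand; last exact: symmetric_tilted_form.
  rewrite -EFinM -(mulrA (K j)) -expRD; congr (_ * expR _)%:E.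
  by rewrite /pivot exprMn r2; field.
rewrite ge0_integralZl//.
- rewrite mgf01; last by rewrite opprB addrC subrK.
  rewrite Ksuc qsuc opprB addrC subrK exprMn r2 -EFinM; congr EFin.
  rewrite -!mulrA; congr (_ * _); rewrite mulrCA; congr (_ * _).
  rewrite -expRD; congr expR; field.
  by rewrite gt_eqF.
- apply/measurable_EFinP; apply: measurableT_comp => //; apply: measurable_funD.
    exact: measurable_funM.
  by apply: measurable_funM => //; exact: measurable_funX.
- rewrite lee_fin mulr_ge0 ?expR_ge0//.
  by apply: prodr_ge0 => i _; rewrite invr_ge0 sqrtr_ge0.
Qed.

(** Lower tail: the same step with the characteristic function in place of the
    Laplace transform. *)
Lemma integral_expR_squares_cos (c_lt0 : c < 0)
  (chf : forall u, (\int[P]_w (cos (Y u w))%:E = (expR (- (b u u / 2)))%:E)%E) j u :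
  (j <= N)%N ->
  (\int[P]_w (expR (c / 2 * F j w) * cos (Y u w))%:E =
   (K j * expR (- (q j u u / 2)))%:E)%E.
Proof.
elim: j u => [|j IH] u jN.
  rewrite /tilt_mass big_ord0 mul1r -chf.
  by apply: eq_integral => w _; rewrite big_ord0 mulr0 expR0 mul1r.
have p0 := pivot0 jN.
set g := Y (e j); set r := Num.sqrt (- c).
have r2 : r ^+ 2 = - c by rewrite sqr_sqrtr// oppr_ge0 ltW.
have K0 : 0 <= K j.
  by apply: prodr_ge0 => i _; rewrite invr_ge0 sqrtr_ge0.
have E1 w : expR (c / 2 * F j w) <= 1.
  rewrite -[leRHS]expR0 ler_expR mulr_le0_ge0 ?sumr_ge0//; first by lra.
  by move=> i _; exact: sqr_ge0.
pose f0 (z : T * measurableTypeR R) :=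
  expR (c / 2 * F j z.1) * cos (Y u z.1) * cos (r * g z.1 * z.2).
pose f z := (f0 z)%:E.
have mf0 : measurable_fun setT f0.
  apply: measurable_funM; first apply: measurable_funM.
  - apply: measurableT_comp => //; apply: measurable_funM => //.
    exact: (mfst (mF j)).
  - by apply: measurableT_comp => //; exact: (mfst (mY _)).
  - apply: measurableT_comp => //; apply: measurable_funM => //.
    by apply: measurable_funM => //; exact: (mfst (mY _)).
have f1 z : `|f0 z| <= 1.
  rewrite /f0 !normrM ger0_norm ?expR_ge0//.
  by rewrite mulr_ile1 ?mulr_ge0 ?expR_ge0 ?cos_max// mulr_ile1 ?expR_ge0 ?cos_max.
have intf : (P \x gamma)%E.-integrable setT f.
  by apply: (@bounded_integrable _ _ _ (P \x gamma)%E f0 1).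
transitivity (\int[P]_w \int[gamma]_t f (w, t))%E.
  apply: eq_integral => w _; rewrite /f /f0 /=.
  under eq_integral do rewrite EFinM.
  rewrite integralZl//; last first.
    apply: (@bounded_integrable _ _ _ gamma _ 1) => //; last by move=> t; exact: cos_max.
    by apply: measurableT_comp => //; exact: measurable_funM.
  rewrite normal_cos ?oner_neq0// -EFinM; congr EFin.
  rewrite big_ord_recr/= mulrDr -/g expRD mulrAC; congr (_ * _ * expR _).
  by rewrite expr1n mul1r exprMn r2; field.
rewrite Fubini//.
have E2 : (\int[gamma]_t \int[P]_w f (w, t) =
    \int[gamma]_t ((K j / 2 * expR (- (q j u u / 2)))%:E *
      ((expR (- r * q j u (e j) * t + (1 - pivot b e c j) / 2 * t ^+ 2))%:E +
       (expR (r * q j u (e j) * t + (1 - pivot b e c j) / 2 * t ^+ 2))%:E))%E)%E.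
  apply: eq_integral => t _; rewrite /f /f0 /=.
  pose h k w := expR (c / 2 * F j w) * cos (Y (u + k *: e j) w).
  have ih k : P.-integrable setT (EFin \o h k).
    apply: (@bounded_integrable _ _ _ P _ 1).
      apply: measurable_funM; last by apply: measurableT_comp => //; exact: mY.
      by apply: measurableT_comp => //; apply: measurable_funM => //; exact: mF.
    move=> w; rewrite normrM ger0_norm ?expR_ge0//.
    by rewrite mulr_ile1 ?expR_ge0 ?cos_max.
  have e2 w : expR (c / 2 * F j w) * cos (Y u w) * cos (r * g w * t) =
      2^-1 * (h (r * t) w + h (- (r * t)) w).
    rewrite /h !YD mulNr cosB cosD -/g.
    by rewrite [r * t * g w](_ : _ = r * g w * t); [field | ring].
  under eq_integral do rewrite e2 EFinM EFinD.
  rewrite integralZl//; last by apply: integrableD => //; exact: ih.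
  rewrite integralD//; [|exact: ih..].
  rewrite !IH ?(ltnW jN)//.
  rewrite !form_expand; [|exact: symmetric_tilted_form..].
  rewrite -!EFinD -!EFinM; congr EFin.
  set Q := q j u u; set a := q j u (e j); set p := pivot b e c j.
  have es : q j (e j) (e j) * c = 1 - p by rewrite /p /pivot; ring.
  have -> : - ((Q + 2 * (r * t) * a + (r * t) ^+ 2 * q j (e j) (e j)) / 2) =
      - (Q / 2) + (- r * a * t + (1 - p) / 2 * t ^+ 2).
    by rewrite exprMn r2 -es; field.
  have -> : - ((Q + 2 * - (r * t) * a + (- (r * t)) ^+ 2 * q j (e j) (e j)) / 2) =
      - (Q / 2) + (r * a * t + (1 - p) / 2 * t ^+ 2).
    by rewrite sqrrN exprMn r2 -es; field.
  by rewrite !expRD; ring.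
rewrite {}E2.
have mE x y : measurable_fun [set: R] (fun t : R => expR (x * t + y / 2 * t ^+ 2)).
  apply: measurableT_comp => //; apply: measurable_funD; first exact: measurable_funM.
  by apply: measurable_funM => //; exact: measurable_funX.
rewrite ge0_integralZl//; last first.
- by rewrite lee_fin mulr_ge0 ?expR_ge0// divr_ge0.
- by move=> t _; rewrite -EFinD lee_fin addr_ge0// expR_ge0.
- by apply: emeasurable_funD; apply/measurable_EFinP; exact: mE.
rewrite ge0_integralD//; last 2 first.
- by apply/measurable_EFinP; exact: mE.
- by apply/measurable_EFinP; exact: mE.
rewrite !mgf01; [|by rewrite opprB addrC subrK..].
rewrite Ksuc qsuc -EFinD -EFinM; congr EFin.
have -> : 1 - (1 - pivot b e c j) = pivot b e c j by ring.
set p := pivot b e c j; set Q := q j u u; set a := q j u (e j).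
rewrite !exprMn sqrrN r2.
have -> : - ((Q + c / p * a ^+ 2) / 2) = - (Q / 2) + - c * a ^+ 2 / (2 * p).
  by field; rewrite gt_eqF.
by rewrite expRD; field; rewrite gt_eqF// sqrtr_gt0.
Qed.

End gaussian_family.

Section concentration.
Context {R : realType} {d : measure_display} {T : measurableType d}.
Variables (P : probability T R) (V : lmodType R) (Y : V -> T -> R).
Hypothesis mY : forall u, measurable_fun setT (Y u).
Hypothesis Y_lin : forall a u v w, Y (a *: u + v) w = a * Y u w + Y v w.
Variables (b : V -> V -> R) (e : nat -> V) (L : R) (N : nat).
Hypothesis sb : symmetric_form b.
Hypothesis b_ge0 : forall u, 0 <= b u u.
Hypothesis L0 : 0 < L.
Hypothesis b_le : forall (j : nat) (tau : nat -> R), (j <= N)%N ->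
  b (\sum_(i < j) tau i *: e i) (\sum_(i < j) tau i *: e i) <=
  L * \sum_(i < j) tau i ^+ 2.
Hypothesis b_diag : forall i, (i < N)%N -> b (e i) (e i) <= L.
Hypothesis lap : forall u,
  (\int[P]_w (expR (Y u w))%:E = (expR (b u u / 2))%:E)%E.
Hypothesis chf : forall u,
  (\int[P]_w (cos (Y u w))%:E = (expR (- (b u u / 2)))%:E)%E.

(** Positive [c] serves the upper tail and negative [c] the lower tail. *)
Lemma laplace_squares_le c : c != 0 -> 2 * c * L < 1 ->
  (\int[P]_w (expR (c / 2 * \sum_(i < N) Y (e i) w ^+ 2))%:E <=
   (expR (c * (\sum_(i < N) b (e i) (e i) / (2 * (1 - 2 * c * L)))))%:E)%E.
Proof.
move=> c0 cL; have p0 := pivot_gt0 sb L0 b_ge0 b_le b_diag c0 cL.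
have mass := tilt_mass_le sb L0 b_ge0 b_le b_diag c0 cL.
have Y0 w : Y 0 w = 0 by have := Y_lin (-1) 0 0 w; rewrite scaler0 addr0; lra.
have q0 : tilted_form b e c N 0 0 = 0.
  have [qC qL] := symmetric_tilted_form e c N sb.
  by have := qL (-1) 0 0 0; rewrite scaler0 addr0; lra.
apply: (@le_trans _ _ (tilt_mass b e c N)%:E); last by rewrite lee_fin.
have [c_lt0|c_gt0|c_eq0] := ltgtP c 0; last by rewrite c_eq0 eqxx in c0.
- have := integral_expR_squares_cos mY Y_lin sb p0 c_lt0 chf 0 (leqnn N).
  rewrite q0 mul0r oppr0 expR0 mulr1 => <-.
  by under [leRHS]eq_integral do rewrite Y0 cos0 mulr1.
- have := integral_expR_squares mY Y_lin sb p0 c_gt0 lap 0 (leqnn N).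
  rewrite q0 mul0r expR0 mulr1 => <-.
  by under [leRHS]eq_integral do rewrite Y0 addr0.
Qed.

(** With [L] the norm of the covariance form and trace one, the sum of squares
    deviates from one by [t] with sub-Gaussian probability; [s] is the sign of
    the deviation. *)
Lemma concentration_squares s t : `|s| = 1 -> 0 < t <= 2 ->
  \sum_(i < N) b (e i) (e i) = 1 ->
  (\int[P]_w (expR (s * t / (16 * L) *
      (\sum_(i < N) Y (e i) w ^+ 2 - 1 - s * t)))%:E <=
   (expR (- (t ^+ 2 / (32 * L))))%:E)%E.
Proof.
move=> s1 /andP[t0 t2] tr1.
have s2 : s ^+ 2 = 1 by rewrite -real_normK ?num_real// s1 expr1n.
(* the minimiser of [2 * c ^+ 2 * L - c * s * t / 2], which bounds the exponent *)
pose c := s * t / (8 * L).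
have s0 : s != 0 by rewrite -normr_eq0 s1 oner_neq0.
have c0 : c != 0 by rewrite /c !mulf_neq0// ?invr_neq0 ?mulf_neq0 ?gt_eqF.
have cLE : 2 * c * L = s * t / 4 by rewrite /c; field; rewrite gt_eqF.
have st : s * t <= t by rewrite ler_piMl// ?(ltW t0)// -s1 ler_norm.
have cL : 2 * c * L < 1 by rewrite cLE; lra.
have h := laplace_squares_le c0 cL.
pose k := expR (- (c / 2 * (1 + s * t))).
have -> : (\int[P]_w (expR (s * t / (16 * L) *
      (\sum_(i < N) Y (e i) w ^+ 2 - 1 - s * t)))%:E =
    k%:E * \int[P]_w (expR (c / 2 * \sum_(i < N) Y (e i) w ^+ 2))%:E)%E.
  rewrite -ge0_integralZl//; last 2 first.
  - apply/measurable_EFinP; apply: measurableT_comp => //.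
    apply: measurable_funM => //; apply: measurable_sum => i.
    by apply: measurable_funX; exact: mY.
  - by rewrite lee_fin expR_ge0.
  apply: eq_integral => w _; rewrite -EFinM -expRD; congr (expR _)%:E.
  by rewrite /c; field; rewrite gt_eqF.
apply: (le_trans (lee_wpmul2l _ h)); first by rewrite lee_fin expR_ge0.
rewrite -EFinM -expRD lee_fin ler_expR.
have -> : \sum_(i < N) b (e i) (e i) / (2 * (1 - 2 * c * L)) = 1 / (2 * (1 - 2 * c * L)).
  by rewrite -mulr_suml tr1.
have q0 : 1 / 2 <= 1 - 2 * c * L by rewrite cLE; lra.
have -> : c * (1 / (2 * (1 - 2 * c * L))) = c / 2 + c ^+ 2 * L / (1 - 2 * c * L).
  by field; rewrite gt_eqF//; lra.
have : c ^+ 2 * L / (1 - 2 * c * L) <= 2 * (c ^+ 2 * L).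
  have : 0 <= c ^+ 2 * L by rewrite mulr_ge0 ?sqr_ge0// ltW.
  by rewrite ler_pdivrMr; [nra | lra].
have -> : 2 * (c ^+ 2 * L) = t ^+ 2 / (32 * L).
  by rewrite /c !exprMn s2; field; rewrite gt_eqF.
have -> : - (c / 2 * (1 + s * t)) = - (c / 2) - t ^+ 2 / (16 * L).
  rewrite /c (_ : t ^+ 2 = s ^+ 2 * t ^+ 2); last by rewrite s2 mul1r.
  by field; rewrite gt_eqF.
have -> : t ^+ 2 / (16 * L) = 2 * (t ^+ 2 / (32 * L)).
  by field; rewrite gt_eqF.
lra.
Qed.

End concentration.

(** The Borel-Cantelli lemma in mean form: the sum of the sequence has a finite
    expectation, hence converges almost surely, and its terms tend to zero. *)
Lemma ae_eventually_le1 (R : realType) (d : measure_display) (T : measurableType d)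
    (P : probability T R) (W : nat -> T -> R) (v : nat -> R) :
  (forall n, measurable_fun setT (W n)) -> (forall n w, 0 <= W n w) ->
  (forall n, (\int[P]_w (W n w)%:E <= (v n)%:E)%E) ->
  (\sum_(n <oo) (v n)%:E < +oo)%E ->
  {ae P, forall w, \forall n \near \oo, W n w <= 1}.
Proof.
move=> mW W0 Wv sv.
pose S w := (\sum_(n <oo) (W n w)%:E)%E.
have iS : P.-integrable setT S.
  apply/integrableP; split.
    apply: (@ge0_emeasurable_sum _ _ _ _ (fun n w => (W n w)%:E) xpredT).
      by move=> n w _ _; rewrite lee_fin.
    by move=> n _; exact/measurable_EFinP.
  rewrite (eq_integral S); last first.
    by move=> w _; rewrite gee0_abs//; apply: nneseries_ge0 => n _ _; rewrite lee_fin.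
  rewrite integral_nneseries//; last 2 first.
  - by move=> n; exact/measurable_EFinP.
  - by move=> n w _; rewrite lee_fin.
  apply: le_lt_trans sv; apply: lee_nneseries => // n _ _.
  by apply: integral_ge0 => w _; rewrite lee_fin.
have := integrable_ae measurableT iS; apply: filterS => w /= /(_ I) fS.
have Soo : (\sum_(n <oo) (W n w)%:E < +oo)%E.
  by rewrite -ge0_fin_numE//; apply: nneseries_ge0 => n _ _; rewrite lee_fin.
have tail := nneseries_tail_cvg Soo (fun n _ => W0 n w).
have : \forall n \near \oo, (\sum_(n <= k <oo) (W k w)%:E < 1)%E.
  exact: (tail _ (@nbhs_open_ereal_lt R 0 (cst 1) ltr01)).
apply: filterS => n /ltW Wn; rewrite -lee_fin; apply: le_trans Wn.
have := @nneseries_lim_ge R (fun k => (W k w)%:E) xpredT n n.+1.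
by rewrite big_nat1; apply=> k _ _; rewrite lee_fin.
Qed.

(** * Growth rates *)

Section growth.
Context {R : realType}.
Implicit Types (a g : R).

Lemma ln_near_le g : 0 < g -> \forall n \near \oo, ln n.+1%:R <= g * n%:R :> R.
Proof.
move=> g0; pose h := g / 2; have h0 : 0 < h by rewrite divr_gt0.
near=> n.
have -> : ln n.+1%:R = ln (h * n.+1%:R) - ln h :> R.
  by rewrite lnM ?posrE ?ltr0n// addrC addKr.
have hn0 : 0 < h * n.+1%:R :> R by rewrite mulr_gt0// ltr0n.
have : ln (h * n.+1%:R) <= h * n.+1%:R - 1.
  rewrite -{1}(subrK 1 (h * n.+1%:R)) addrC.
  by apply: le_ln1Dx; lra.
have : (h - ln h) / h <= n%:R by near: n; exact: nbhs_infty_ger.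
rewrite ler_pdivrMr// -natr1 /h; lra.
Unshelve. all: by end_near. Qed.

Lemma cvg_ln_div : n%:R^-1 * ln n.+1%:R @[n --> \oo] --> (0 : R).
Proof.
apply/cvgr0Pnorm_le => e e0; near=> n.
have n0 : 0 < n%:R :> R by rewrite ltr0n; near: n; exact: nbhs_infty_gt.
rewrite ger0_norm; last first.
  by apply: mulr_ge0; [rewrite invr_ge0 | apply: ln_ge0; rewrite ler1n].
by rewrite mulrC ler_pdivrMr//; near: n; exact: ln_near_le.
Unshelve. all: by end_near. Qed.

Lemma powR2E g (n : nat) : (2 : R) `^ (g * n%:R) = expR (g * ln 2 * n%:R).
Proof. by rewrite /powR pnatr_eq0/=; congr expR; ring. Qed.

Lemma cvg_poly_exp a g : 0 < g ->
  n.+1%:R `^ a * 2 `^ (- g * n%:R) @[n --> \oo] --> (0 : R).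
Proof.
move=> g0; have l2 : 0 < ln 2 :> R by rewrite ln_gt0// ltr1n.
pose h := g * ln 2 / 2; have h0 : 0 < h by rewrite divr_gt0// mulr_gt0.
pose A := `|a| + 1; have A0 : 0 < A by rewrite ltr_wpDl.
apply: (@squeeze_cvgr _ _ _ _ (cst 0) (fun n => h^-1 * n%:R^-1)).
- near=> n.
  have n0 : 0 < n%:R :> R by rewrite ltr0n; near: n; exact: nbhs_infty_gt.
  apply/andP; split; first by rewrite mulr_ge0 ?powR_ge0.
  rewrite powR2E {1}/powR pnatr_eq0/= -expRD.
  apply: (@le_trans _ _ (expR (- (h * n%:R)))).
    rewrite ler_expR.
    have l0 : 0 <= ln n.+1%:R :> R by apply: ln_ge0; rewrite ler1n.
    have : ln n.+1%:R <= h / A * n%:R :> R.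
      by near: n; apply: ln_near_le; rewrite divr_gt0.
    move=> /(ler_wpM2l (ltW A0)).
    rewrite [A * (h / A * _)](_ : _ = h * n%:R); last by field; rewrite gt_eqF.
    move=> h1.
    have : a * ln n.+1%:R <= A * ln n.+1%:R.
      by apply: ler_wpM2r => //; rewrite (le_trans (ler_norm a))// lerDl.
    have : g * ln 2 = 2 * h by rewrite /h; field.
    move=> e; rewrite mulNr mulNr e; lra.
  rewrite expRN -invfM lef_pV2 ?posrE ?expR_gt0 ?mulr_gt0//.
  by apply: (le_trans _ (expR_ge1Dx _)); rewrite lerDr.
- exact: cvg_cst.
- rewrite -[X in _ --> X](mulr0 h^-1).
  by apply: cvgM; [exact: cvg_cst | exact: cvg_invn].
Unshelve. all: by end_near. Qed.

Lemma cvgy_exp_poly a g : 0 < g ->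
  2 `^ (g * n%:R) / n.+1%:R `^ a @[n --> \oo] --> (+oo : set_system R).
Proof.
move=> g0; apply/gtr0_cvgV0; first by near=> n; rewrite divr_gt0 ?powR_gt0// ltr0n.
have := cvg_poly_exp a g0; apply: cvg_trans; apply: near_eq_cvg; near=> n.
by rewrite /= invf_div mulNr powRN.
Unshelve. all: by end_near. Qed.

Lemma cvgy_sqrt_ln : Num.sqrt (ln n%:R) @[n --> \oo] --> (+oo : set_system R).
Proof.
apply/cvgryPge => A; near=> n.
have [A0|A0] := leP A 0; first exact: le_trans (sqrtr_ge0 _).
rewrite -[leLHS]ger0_norm ?(ltW A0)// -sqrtr_sqr; apply: ler_wsqrtr.
have n0 : 0 < n%:R :> R by rewrite ltr0n; near: n; exact: nbhs_infty_gt.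
rewrite -ler_expR lnK ?posrE//.
by near: n; exact: nbhs_infty_ger.
Unshelve. all: by end_near. Qed.

End growth.

(** * Dyadic increments and Faber-Schauder coefficients *)

Section power_mean.
Context {R : realType}.

(** A mean that is not much smaller than the maximum is carried by a positive
    fraction of the terms, which bounds every power mean from below. *)
Lemma sum_powR_ge (N : nat) (a : nat -> R) (M c p : R) :
  0 < c -> 0 < M -> 0 <= p ->
  (forall k, (k < N)%N -> 0 <= a k <= M) ->
  c * N%:R <= \sum_(0 <= k < N) a k ->
  N%:R * ((c / 2) `^ p * (c / (2 * M))) <= \sum_(0 <= k < N) (a k) `^ p.
Proof.
move=> c0 M0 p0 aM sa.
have term k : (k < N)%N -> (c / 2) `^ p * ((a k - c / 2) / M) <= (a k) `^ p.
  move=> kN; have /andP[ak0 akM] := aM k kN.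
  have [ca|ca] := leP (c / 2) (a k).
  - apply: (@le_trans _ _ ((c / 2) `^ p)).
      rewrite ler_piMr ?powR_ge0// ler_pdivrMr// mul1r; lra.
    by apply: ge0_ler_powR => //; rewrite nnegrE// divr_ge0// ltW.
  - apply: (@le_trans _ _ 0); last exact: powR_ge0.
    by rewrite mulr_ge0_le0 ?powR_ge0// mulr_le0_ge0 ?invr_ge0 ?(ltW M0)//; lra.
apply: (@le_trans _ _ (\sum_(0 <= k < N) (c / 2) `^ p * ((a k - c / 2) / M))); last first.
  by apply: ler_sum_nat => k /andP[_ kN]; exact: term.
rewrite -mulr_sumr mulrCA; apply: ler_wpM2l; first exact: powR_ge0.
rewrite -mulr_suml sumrB sumr_const_nat subn0 -mulr_natr.
by rewrite invfM !mulrA ler_pM2r ?invr_gt0//; lra.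
Qed.

Lemma sum_powR_le (N : nat) (a : nat -> R) (M p : R) : 0 <= p ->
  (forall k, (k < N)%N -> 0 <= a k <= M) ->
  \sum_(0 <= k < N) (a k) `^ p <= N%:R * M `^ p.
Proof.
move=> p0 aM; rewrite mulr_natl -[X in _ *+ X]subn0 -sumr_const_nat.
apply: ler_sum_nat => k /andP[_ kN]; have /andP[a0 h] := aM k kN.
by apply: ge0_ler_powR => //; rewrite nnegrE// (le_trans a0).
Qed.

End power_mean.

Section faber_schauder_identities.
Context {R : realType}.
Implicit Types (x : R -> R) (m n k : nat).

Definition dyadic_increment x n k : R :=
  x (k.+1%:R / 2 ^+ n) - x (k%:R / 2 ^+ n).

Definition quadratic_variation x n : R :=
  \sum_(0 <= k < 2 ^ n) dyadic_increment x n k ^+ 2.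

Lemma pvariationE x p n :
  pvariation x p n = \sum_(0 <= k < 2 ^ n) `|dyadic_increment x n k| `^ p.
Proof. by []. Qed.

Lemma sum_nat_double (f : nat -> R) n :
  \sum_(0 <= k < 2 * n) f k = \sum_(0 <= k < n) (f (2 * k)%N + f (2 * k).+1).
Proof.
elim: n => [|n IH]; first by rewrite muln0 !big_nil.
rewrite mulnS add2n big_nat_recr// big_nat_recr// IH.
by rewrite [RHS]big_nat_recr//= addrA.
Qed.

Lemma sum_nat_divn (f : nat -> R) (A B : nat) : (0 < B)%N ->
  \sum_(0 <= k < A * B) f (k %/ B)%N = B%:R * \sum_(0 <= k < A) f k.
Proof.
move=> B0; elim: A => [|A IH]; first by rewrite mul0n !big_nil mulr0.
rewrite mulSn addnC (@big_cat_nat _ _ _ (A * B)) ?leq_addr//= IH.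
rewrite big_nat_recr//= mulrDr; congr (_ + _).
rewrite -[X in \sum_(X <= _ < _) _]add0n big_addn addnC addnK.
rewrite (eq_big_nat _ _ (F2 := fun=> f A)); last first.
  by move=> k /andP[_ kB]; rewrite addnC divnMDl// divn_small// addn0.
by rewrite sumr_const_nat subn0 mulr_natl.
Qed.

Lemma half_dyadic n k : (k%:R / 2 ^+ n : R) = (2 * k)%:R / 2 ^+ n.+1.
Proof. by rewrite natrM exprS invfM mulrACA divff ?mul1r// pnatr_eq0. Qed.

Lemma dyadic_incrementD x n k : dyadic_increment x n k =
  dyadic_increment x n.+1 (2 * k) + dyadic_increment x n.+1 (2 * k).+1.
Proof.
rewrite /dyadic_increment (half_dyadic n k) (half_dyadic n k.+1).
have -> : (2 * k.+1 = (2 * k).+2)%N by rewrite mulnS.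
by rewrite [RHS]addrC addrA subrK.
Qed.

Lemma sqr_faber_schauder x m k : faber_schauder x m k ^+ 2 =
  2 ^+ m * (dyadic_increment x m.+1 (2 * k)
            - dyadic_increment x m.+1 (2 * k).+1) ^+ 2.
Proof.
rewrite /faber_schauder exprMn; congr (_ * _ ^+ 2).
  rewrite -(powR_mulrn 2 (powR_ge0 _ _)) -powRrM divfK ?pnatr_eq0//.
  by rewrite powR_mulrn.
rewrite /dyadic_increment (half_dyadic m k) (half_dyadic m k.+1) addn1.
have -> : (2 * k.+1 = (2 * k).+2)%N by rewrite mulnS.
ring.
Qed.

(** A coefficient is a difference of two neighbouring increments, whose sum is an
    increment of the previous level: by the parallelogram identity the sums of
    squares telescope to a quadratic variation. *)
Lemma sqr_fs_norm x n :
  fs_norm x n ^+ 2 = 2 ^+ n * quadratic_variation x n - (x 1 - x 0) ^+ 2.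
Proof.
rewrite /fs_norm sqr_sqrtr; last first.
  by apply: sumr_ge0 => m _; apply: sumr_ge0 => k _; exact: sqr_ge0.
elim: n => [|n IH].
  rewrite big_nil /quadratic_variation expn0 big_nat1 /dyadic_increment.
  by rewrite expr0 mul1r !divr1 subrr.
rewrite big_nat_recr//= IH /quadratic_variation expnS sum_nat_double.
rewrite addrAC; congr (_ - _).
rewrite !mulr_sumr -big_split/=; apply: eq_bigr => k _.
by rewrite sqr_faber_schauder (dyadic_incrementD x n k) (exprS _ n); ring.
Qed.

(** The weighted squares of the coefficients on the branch of the dyadic tree
    that leads to the [k]-th interval of level [n - 1]. *)
Definition fs_energy x n k : R :=
  \sum_(0 <= m < n) 2 ^+ m * faber_schauder x m (k %/ 2 ^ (n.-1 - m)) ^+ 2.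

(** A coefficient of level [m] is counted once for each of its descendants, and
    the weight [2 ^+ m] compensates for their number. *)
Lemma sum_fs_energy x n : (0 < n)%N ->
  \sum_(0 <= k < 2 ^ n.-1) fs_energy x n k = 2 ^+ n.-1 * fs_norm x n ^+ 2.
Proof.
move=> n0; rewrite /fs_norm sqr_sqrtr; last first.
  by apply: sumr_ge0 => m _; apply: sumr_ge0 => k _; exact: sqr_ge0.
rewrite /fs_energy exchange_big/= mulr_sumr.
apply: eq_big_nat => m /andP[_ mn]; rewrite -mulr_sumr.
have mn1 : (m <= n.-1)%N by rewrite -ltnS prednK.
have e : (2 ^ n.-1 = 2 ^ m * 2 ^ (n.-1 - m))%N by rewrite -expnD subnKC.
rewrite [in LHS]e (sum_nat_divn (fun k => faber_schauder x m k ^+ 2)) ?expn_gt0//.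
by rewrite mulrA natrX -exprD subnKC.
Qed.

Lemma fs_energy_ge0 x n k : 0 <= fs_energy x n k.
Proof. by apply: sumr_ge0 => m _; rewrite mulr_ge0 ?sqr_ge0// exprn_ge0. Qed.

Lemma jensen_meanE x p n : jensen_mean x p n =
  (2 ^+ n.-1)^-1 * \sum_(0 <= k < 2 ^ n.-1) fs_energy x n k `^ (p / 2).
Proof. by []. Qed.

End faber_schauder_identities.

(** * Paths with concentrated quadratic variation *)

Section powers_of_two.
Context {R : realType}.
Implicit Types a b : R.

Lemma pow2_gt0 a : 0 < (2 : R) `^ a.
Proof. exact: powR_gt0. Qed.

Lemma pow2D a b : (2 : R) `^ (a + b) = 2 `^ a * 2 `^ b.
Proof. by rewrite powRD// pnatr_eq0 implybT. Qed.

Lemma pow2N a : (2 : R) `^ (- a) = (2 `^ a)^-1.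
Proof. exact: powRN. Qed.

Lemma pow2n (n : nat) : (2 : R) `^ n%:R = 2 ^+ n.
Proof. by rewrite powR_mulrn. Qed.

Lemma pow2_le a b : a <= b -> (2 : R) `^ a <= 2 `^ b.
Proof. by move=> ab; rewrite ler_powR// ler1n. Qed.

Lemma powRV a b : 0 <= a -> a^-1 `^ b = (a `^ b)^-1.
Proof. by move=> a0; rewrite -(powR_inv1 a0) -powRrM mulN1r powRN. Qed.

Lemma pow2X a (n : nat) : ((2 : R) `^ a) ^+ n = 2 `^ (a * n%:R).
Proof. by rewrite -(powR_mulrn n (powR_ge0 _ _)) powRrM. Qed.

End powers_of_two.

Section roughness_of_a_path.
Context {R : realType}.
Variables (H : R) (hH : 0 < H < 1).

(** Half the exponent at which the norm of the covariance matrix of the normalised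
    increments decays: [2^-1] as for independent increments, or [1 - H] under the
    long memory of [H > 2^-1].  A Lipschitz drift also perturbs the normalised
    quadratic variation with exponent [1 - H]. *)
Definition hurst_gap : R := Num.min 2^-1 (1 - H).

(** The relative precision at which the quadratic variation of fractional
    Brownian motion identifies its scale. *)
Definition fluctuation (n : nat) : R :=
  2 `^ (- hurst_gap * n%:R) * Num.sqrt (ln n%:R).

(** The order of the squared norm of the coefficients up to level [n]. *)
Definition scale (n : nat) : R := 2 `^ (2 * (1 - H) * n%:R).

Lemma hurst_gap_gt0 : 0 < hurst_gap.
Proof. by rewrite lt_min invr_gt0 ltr0n/= subr_gt0; case/andP: hH. Qed.

Lemma scale_gt0 n : 0 < scale n.
Proof. exact: pow2_gt0. Qed.

Lemma fluctuation_ge0 n : 0 <= fluctuation n.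
Proof. by rewrite mulr_ge0 ?powR_ge0 ?sqrtr_ge0. Qed.

Lemma cvg_fluctuation : fluctuation n @[n --> \oo] --> 0.
Proof.
apply: (@squeeze_cvgr _ _ _ _ (cst 0)
  (fun n => n.+1%:R `^ 1 * 2 `^ (- hurst_gap * n%:R))).
- near=> n; have n0 : (0 : R) < n%:R by rewrite ltr0n; near: n; exact: nbhs_infty_gt.
  rewrite fluctuation_ge0 /= /fluctuation mulrC.
  apply: ler_wpM2r; first exact: powR_ge0.
  rewrite powRr1//.
  have l : ln n%:R <= n%:R :> R.
    rewrite -ler_expR lnK ?posrE//; apply: le_trans (expR_ge1Dx _); lra.
  rewrite -[leRHS]ger0_norm// -sqrtr_sqr; apply: ler_wsqrtr; apply: (le_trans l).
  rewrite -natr1; have := sqr_ge0 (n%:R : R); lra.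
- exact: cvg_cst.
- exact: cvg_poly_exp hurst_gap_gt0.
Unshelve. all: by end_near. Qed.

(** Lower order errors are absorbed by the logarithmic factor. *)
Lemma near_le_fluctuation (K g : R) : hurst_gap <= g ->
  \forall n \near \oo, K * 2 `^ (- g * n%:R) <= fluctuation n.
Proof.
move=> gg; near=> n; rewrite /fluctuation mulrC.
have KS : `|K| <= Num.sqrt (ln n%:R).
  by near: n; have := @cvgy_sqrt_ln R => /cvgryPge; exact.
apply: (@le_trans _ _ (2 `^ (- g * n%:R) * `|K|)).
  by apply: ler_wpM2l; [exact: powR_ge0 | exact: ler_norm].
apply: ler_pM => //.
by apply: pow2_le; rewrite !mulNr lerN2 ler_wpM2r.
Unshelve. all: by end_near. Qed.

Lemma scaleE n : scale n = 2 ^+ n / 2 `^ ((2 * H - 1) * n%:R).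
Proof. by rewrite /scale -pow2n -pow2N -pow2D; congr (_ `^ _); ring. Qed.

Variables (x : R -> R) (C kap : R).
Hypothesis C1 : 1 <= C.
Hypothesis modulus : forall n k, (k < 2 ^ n)%N ->
  `|dyadic_increment x n k| <= C * n.+1%:R * 2 `^ (- (H * n%:R)).
Hypothesis concentrated : \forall n \near \oo,
  `|2 `^ ((2 * H - 1) * n%:R) * quadratic_variation x n - 1| <= kap * fluctuation n.

Let C0 : 0 <= C. Proof. exact: le_trans C1. Qed.

(** The total increment in the telescoped identity is a constant, which is
    negligible against the growing scale. *)
Lemma near_fs_norm : \forall n \near \oo,
  `|fs_norm x n ^+ 2 / scale n - 1| <= (kap + 1) * fluctuation n.
Proof.
have g : hurst_gap <= 2 * (1 - H).
  by rewrite /hurst_gap ge_min; apply/orP; right; case/andP: hH; lra.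
near=> n.
have h1 : `|2 `^ ((2 * H - 1) * n%:R) * quadratic_variation x n - 1| <=
    kap * fluctuation n by near: n; exact: concentrated.
have h2 : C ^+ 2 * 2 `^ (- (2 * (1 - H)) * n%:R) <= fluctuation n.
  by near: n; exact: near_le_fluctuation.
rewrite sqr_fs_norm mulrBl.
have -> : 2 ^+ n * quadratic_variation x n / scale n =
    2 `^ ((2 * H - 1) * n%:R) * quadratic_variation x n.
  have p0 := pow2_gt0 ((2 * H - 1) * n%:R : R).
  rewrite scaleE; field; rewrite gt_eqF//.
  by rewrite expf_neq0// pnatr_eq0.
rewrite addrAC [(kap + 1) * _]mulrDl [1 * fluctuation n]mul1r.
apply: (le_trans (ler_normB _ _)); apply: lerD => //.
apply: le_trans h2; rewrite mulNr pow2N -/(scale n) ger0_norm; last first.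
  by rewrite divr_ge0 ?sqr_ge0// ltW// scale_gt0.
rewrite ler_pM2r ?invr_gt0 ?scale_gt0// -[leLHS]real_normK ?num_real//.
have := @modulus 0 0 isT; rewrite /dyadic_increment expr0 !divr1 mulr0 oppr0 powRr0 !mulr1.
by move=> h; rewrite ler_sqr ?nnegrE.
Unshelve. all: by end_near. Qed.

Lemma near_fs_norm_bounds : \forall n \near \oo,
  scale n / 2 <= fs_norm x n ^+ 2 <= 2 * scale n.
Proof.
have c0 : (kap + 1) * fluctuation n @[n --> \oo] --> 0.
  by rewrite -[X in _ --> X](mulr0 (kap + 1)); apply: cvgM; [exact: cvg_cst | exact: cvg_fluctuation].
near=> n; have s0 := scale_gt0 n.
have h : `|fs_norm x n ^+ 2 / scale n - 1| <= (kap + 1) * fluctuation n.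
  by near: n; exact: near_fs_norm.
have h2 : (kap + 1) * fluctuation n <= 2^-1.
  by near: n; apply: (cvgr_le _ c0); rewrite invr_gt0.
have := le_trans h h2; rewrite ler_norml -(@ler_pM2r _ (scale n))// -[X in _ && X](@ler_pM2r _ (scale n))//.
rewrite mulrBl divfK ?gt_eqF// mul1r; lra.
Unshelve. all: by end_near. Qed.

(** The polynomial loss between the largest energy of level [n] and the mean. *)
Definition energy_factor (n : nat) : R := 16 * C ^+ 2 * n.+1%:R ^+ 3.

Lemma energy_factor_ge1 n : 1 <= energy_factor n.
Proof.
have c : 1 <= C ^+ 2 by rewrite exprn_ege1.
have m : 1 <= n.+1%:R ^+ 3 :> R by rewrite exprn_ege1// ler1n.
by rewrite /energy_factor -[leLHS]mulr1; apply: ler_pM => //; lra.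
Qed.

(** By the modulus of continuity, the coefficient of level [m] contributes at
    most [scale m], up to a polynomial factor, and there are [n] levels. *)
Lemma fs_energy_le n k : (0 < n)%N -> (k < 2 ^ n.-1)%N ->
  fs_energy x n k <= energy_factor n * scale n / 4.
Proof.
move=> n0 kn; have [H0 H1] := andP hH.
apply: (@le_trans _ _ (\sum_(0 <= m < n) 4 * C ^+ 2 * n.+1%:R ^+ 2 * scale n)); last first.
  rewrite sumr_const_nat subn0 -[X in X <= _]mulr_natr /energy_factor.
  have s0 := scale_gt0 n.
  have -> : 16 * C ^+ 2 * n.+1%:R ^+ 3 * scale n / 4 =
     4 * C ^+ 2 * n.+1%:R ^+ 2 * scale n * n.+1%:R by field.
  apply: ler_wpM2l; last by rewrite ler_nat.
  by rewrite !mulr_ge0 ?sqr_ge0 ?exprn_ge0// ltW.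
apply: ler_sum_nat => m /andP[_ mn]; rewrite sqr_faber_schauder.
set k' := (k %/ _)%N.
have k'm : (k' < 2 ^ m)%N.
  by rewrite /k' ltn_divLR ?expn_gt0// -expnD subnKC// -ltnS prednK.
have bd i : (i < 2 ^ m.+1)%N -> `|dyadic_increment x m.+1 i| <=
    C * n.+1%:R * 2 `^ (- (H * m%:R)).
  move=> im; apply: (le_trans (modulus im)); apply: ler_pM; rewrite ?powR_ge0//.
  - exact: mulr_ge0.
  - by apply: ler_wpM2l => //; rewrite ler_nat.
  - by apply: pow2_le; rewrite lerN2 ler_pM2l// ler_nat.
have b1 := bd (2 * k')%N; have b2 := bd (2 * k').+1.
have {}b1 : `|dyadic_increment x m.+1 (2 * k')| <= C * n.+1%:R * 2 `^ (- (H * m%:R)).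
  by apply: b1; rewrite expnS ltn_pmul2l.
have {}b2 : `|dyadic_increment x m.+1 (2 * k').+1| <= C * n.+1%:R * 2 `^ (- (H * m%:R)).
  apply: b2; rewrite expnS; apply: (@leq_trans (2 * k'.+1)); first by rewrite mulnS.
  by rewrite leq_mul2l.
set u := dyadic_increment _ _ _ in b1 *; set v := dyadic_increment _ _ _ in b2 *.
set Z := C * n.+1%:R * _ in b1 b2.
have Z0 : 0 <= Z by exact: le_trans b1.
have uv : (u - v) ^+ 2 <= 4 * Z ^+ 2.
  have : `|u - v| <= 2 * Z.
    by apply: (le_trans (ler_normB _ _)); lra.
  move=> h; rewrite -[leLHS]real_normK ?num_real//.
  have -> : 4 * Z ^+ 2 = (2 * Z) ^+ 2 by ring.
  by rewrite ler_sqr ?nnegrE// mulr_ge0.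
apply: (@le_trans _ _ (2 ^+ m * (2 ^+ m * (4 * Z ^+ 2)))).
  by rewrite !ler_pM2l ?exprn_gt0.
have -> : 2 ^+ m * (2 ^+ m * (4 * Z ^+ 2)) =
   4 * C ^+ 2 * n.+1%:R ^+ 2 * (2 ^+ m * 2 ^+ m * 2 `^ (- (H * m%:R)) ^+ 2).
  by rewrite /Z; ring.
apply: ler_wpM2l; first by rewrite !mulr_ge0 ?sqr_ge0.
rewrite -pow2n pow2X -!pow2D; apply: pow2_le.
apply: (@le_trans _ _ (2 * (1 - H) * m%:R)).
  by rewrite le_eqVlt; apply/orP; left; apply/eqP; ring.
by apply: ler_wpM2l; [lra | rewrite ler_nat ltnW].
Qed.

End roughness_of_a_path.

Section consequences.
Context {R : realType}.
Variables (H : R) (hH : 0 < H < 1) (x : R -> R) (C kap : R).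
Hypothesis C1 : 1 <= C.
Hypothesis modulus : forall n k, (k < 2 ^ n)%N ->
  `|dyadic_increment x n k| <= C * n.+1%:R * 2 `^ (- (H * n%:R)).
Hypothesis concentrated : \forall n \near \oo,
  `|2 `^ ((2 * H - 1) * n%:R) * quadratic_variation x n - 1| <=
  kap * fluctuation H n.

Local Notation U := (energy_factor C).
Let C0 : 0 <= C. Proof. exact: le_trans C1. Qed.

Let U_ge1 n : 1 <= U n. Proof. exact: energy_factor_ge1. Qed.

Let U_gt0 n : 0 < U n. Proof. exact: lt_le_trans (U_ge1 n). Qed.

Let fs_ge0 n : 0 <= fs_norm x n. Proof. exact: sqrtr_ge0. Qed.

Let fs_powR p n : fs_norm x n `^ p = (fs_norm x n ^+ 2) `^ (p / 2).
Proof. by rewrite -(powR_mulrn 2 (fs_ge0 n)) -powRrM mulrC divfK. Qed.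

Let subexponential_rho p :
  subexponential (fun n => 2 `^ (p / 2) * U n `^ (1 + p / 2)).
Proof.
have E (n : nat) : n%:R^-1 * ln (2 `^ (p / 2) * U n `^ (1 + p / 2)) =
    (p / 2 * ln 2 + (1 + p / 2) * ln (16 * C ^+ 2)) * n%:R^-1 +
    (1 + p / 2) * 3 * (n%:R^-1 * ln n.+1%:R).
  have c0 : 0 < 16 * C ^+ 2 by rewrite mulr_gt0// exprn_gt0// (lt_le_trans _ C1).
  rewrite lnM ?posrE ?powR_gt0// !ln_powR /energy_factor lnM ?posrE ?exprn_gt0//.
  by rewrite lnXn// -mulr_natr; ring.
rewrite /subexponential; under eq_fun do rewrite E.
pose k := p / 2 * ln 2 + (1 + p / 2) * ln (16 * C ^+ 2).
have h1 : k * n%:R^-1 @[n --> \oo] --> 0.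
  rewrite -[X in _ --> X](mulr0 k).
  by apply: cvgM; [exact: cvg_cst | exact: cvg_invn].
have h2 : (1 + p / 2) * 3 * (n%:R^-1 * ln n.+1%:R) @[n --> \oo] --> 0.
  rewrite -[X in _ --> X](mulr0 ((1 + p / 2) * 3)).
  by apply: cvgM; [exact: cvg_cst | exact: cvg_ln_div].
have := cvgD h1 h2; rewrite addr0; exact.
Qed.

(** The mean of the energies is the squared norm, and their maximum exceeds it by
    a polynomial factor only, so every power mean agrees with the power of the
    mean up to polynomial factors. *)
Lemma path_reverse_jensen : reverse_jensen x.
Proof.
move=> p p1; have p2 : 0 <= p / 2 by rewrite divr_ge0//; lra.
have [n0 _ hn0] : \forall n \near \oo, scale H n / 2 <= fs_norm x n ^+ 2 <= 2 * scale H n.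
  exact: (near_fs_norm_bounds hH C1 modulus concentrated).
have twoge1 : 1 <= (2 : R) `^ (p / 2).
  by rewrite -[leLHS](powRr0 (2 : R)); exact: pow2_le.
have Uge1 n q : 0 <= q -> 1 <= U n `^ q.
  by move=> q0; rewrite -[leLHS](powRr0 (U n)); apply: ler_powR.
exists (maxn 1 n0), (fun n => 2 `^ (p / 2) * U n `^ (1 + p / 2)); split.
- by rewrite leq_max.
- by move=> n; rewrite -[leLHS]mulr1; apply: ler_pM => //; apply: Uge1; lra.
- move=> m n mn; apply: ler_wpM2l => //.
  apply: ge0_ler_powR; rewrite ?nnegrE ?(ltW (U_gt0 _))//; first by lra.
  apply: ler_wpM2l; first by rewrite mulr_ge0 ?sqr_ge0.
  by rewrite lerXn2r ?nnegrE// ler_nat.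
- exact: subexponential_rho.
move=> n; rewrite geq_max => /andP[n_gt0 n0n].
have /andP[lo hi] := hn0 n n0n.
have s0 := scale_gt0 H n; set c := fs_norm x n ^+ 2 in lo hi *.
have c0 : 0 < c by apply: lt_le_trans lo; rewrite divr_gt0.
pose M := U n * scale H n / 4; have M0 : 0 < M by rewrite divr_gt0// mulr_gt0.
have N0 : (0 : R) < 2 ^+ n.-1 by rewrite exprn_gt0.
have aM k : (k < 2 ^ n.-1)%N -> 0 <= fs_energy x n k <= M.
  by move=> kn; rewrite fs_energy_ge0/= (fs_energy_le hH C1 modulus).
have sE := sum_fs_energy x n_gt0.
rewrite jensen_meanE fs_powR -/c.
have e : U n `^ (1 + p / 2) = U n * U n `^ (p / 2).
  by rewrite powRD ?powRr1 ?(ltW (U_gt0 n))// (gt_eqF (U_gt0 n)) implybT.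
apply/andP; split.
- have := @sum_powR_ge _ (2 ^ n.-1) (fs_energy x n) M c (p / 2) c0 M0 p2 aM.
  rewrite sE natrX => /(_ _)/wrap[]; first by rewrite mulrC.
  move=> h; rewrite [leRHS]mulrC ler_pdivlMr//; apply: le_trans h.
  rewrite mulrC; apply: ler_wpM2l; first exact: ltW.
  rewrite e.
  have -> : (c / 2) `^ (p / 2) = c `^ (p / 2) / 2 `^ (p / 2).
    rewrite powRM ?(ltW c0)//.
    by rewrite powRV.
  have cM : (U n)^-1 <= c / (2 * M).
    have M2 : 0 < 2 * M by rewrite mulr_gt0.
    rewrite ler_pdivlMr// /M; apply: le_trans lo.
    by rewrite le_eqVlt; apply/orP; left; apply/eqP; field; rewrite gt_eqF.
  have Up : (U n `^ (p / 2))^-1 <= 1 by rewrite invf_le1 ?powR_gt0// Uge1.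
  have -> : (2 `^ (p / 2) * (U n * U n `^ (p / 2)))^-1 * c `^ (p / 2) =
      c `^ (p / 2) / 2 `^ (p / 2) * ((U n)^-1 * (U n `^ (p / 2))^-1).
    by rewrite !invfM; ring.
  apply: ler_wpM2l; first by apply: divr_ge0; exact: powR_ge0.
  apply: le_trans cM; rewrite -[leRHS]mulr1.
  by apply: ler_wpM2l => //; rewrite invr_ge0 (ltW (U_gt0 n)).
- have := @sum_powR_le _ (2 ^ n.-1) (fs_energy x n) M (p / 2) p2 aM.
  rewrite natrX => h; apply: (@le_trans _ _ (M `^ (p / 2))).
    by rewrite mulrC ler_pdivrMr// [leRHS]mulrC.
  rewrite e; apply: (@le_trans _ _ (U n `^ (p / 2) * c `^ (p / 2))).
    rewrite -powRM ?(ltW c0) ?(ltW (U_gt0 n))//.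
    apply: ge0_ler_powR => //; rewrite ?nnegrE ?(ltW M0) ?mulr_ge0 ?(ltW c0) ?(ltW (U_gt0 n))//.
    rewrite /M -mulrA; apply: ler_wpM2l; first exact: (ltW (U_gt0 n)).
    lra.
  apply: ler_wpM2r; first exact: powR_ge0.
  rewrite mulrA -[leLHS]mul1r; apply: ler_wpM2r; first exact: powR_ge0.
  by rewrite -[leLHS]mulr1; apply: ler_pM.
Qed.

Let near_qv : \forall n \near \oo,
  2^-1 <= 2 `^ ((2 * H - 1) * n%:R) * quadratic_variation x n.
Proof.
have c0 : kap * fluctuation H n @[n --> \oo] --> 0.
  rewrite -[X in _ --> X](mulr0 kap).
  by apply: cvgM; [exact: cvg_cst | exact: cvg_fluctuation].
near=> n.
have h : `|2 `^ ((2 * H - 1) * n%:R) * quadratic_variation x n - 1| <=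
  kap * fluctuation H n by near: n; exact: concentrated.
have h2 : kap * fluctuation H n <= 2^-1.
  by near: n; apply: (cvgr_le _ c0); rewrite invr_gt0.
by have := le_trans h h2; rewrite ler_norml; lra.
Unshelve. all: by end_near. Qed.

Let pvariation_le p n : 0 <= p ->
  pvariation x p n <= C `^ p * (n.+1%:R `^ p * 2 `^ (- (p * H - 1) * n%:R)).
Proof.
move=> p0; rewrite pvariationE.
have aM k : (k < 2 ^ n)%N -> 0 <= `|dyadic_increment x n k| <=
    C * n.+1%:R * 2 `^ (- (H * n%:R)).
  by move=> kn; rewrite normr_ge0 modulus.
apply: (le_trans (sum_powR_le p0 aM)).
rewrite !powRM ?mulr_ge0 ?powR_ge0// natrX -pow2n -powRrM mulrCA -!mulrA -pow2D.
rewrite le_eqVlt; apply/orP; left; apply/eqP; do 2 congr (_ * _).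
by congr (_ `^ _); ring.
Qed.

(** Among the squared increments, the mean is of the order of the maximum, up to a
    polynomial factor. *)
Let pvariation_ge p : 0 < p -> exists2 D, 0 < D & \forall n \near \oo,
  D * (2 `^ ((1 - p * H) * n%:R) / n.+1%:R `^ 2) <= pvariation x p n.
Proof.
move=> p0; pose D := (4^-1 : R) `^ (p / 2) / (4 * C ^+ 2).
have Cp : 0 < C by exact: lt_le_trans C1.
exists D; first by rewrite divr_gt0 ?powR_gt0 ?mulr_gt0 ?exprn_gt0.
near=> n.
have h : 2^-1 <= 2 `^ ((2 * H - 1) * n%:R) * quadratic_variation x n.
  by near: n; exact: near_qv.
pose s := (2 : R) `^ (- (2 * H * n%:R)); have s0 : 0 < s by exact: pow2_gt0.
pose M := C ^+ 2 * n.+1%:R ^+ 2 * s.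
have M0 : 0 < M by rewrite !mulr_gt0 ?exprn_gt0.
have aM k : (k < 2 ^ n)%N -> 0 <= dyadic_increment x n k ^+ 2 <= M.
  move=> kn; rewrite sqr_ge0/= -[leLHS]real_normK ?num_real//.
  have -> : M = (C * n.+1%:R * 2 `^ (- (H * n%:R))) ^+ 2.
    rewrite !exprMn pow2X /M /s; congr (_ * _ `^ _); ring.
  by rewrite ler_sqr ?nnegrE ?modulus// !mulr_ge0 ?powR_ge0.
have c0 : 0 < s / 2 by rewrite divr_gt0.
have lo : s / 2 * (2 ^ n)%:R <= \sum_(0 <= k < 2 ^ n) dyadic_increment x n k ^+ 2.
  rewrite -/(quadratic_variation x n) natrX -(@ler_pM2l _ (2 `^ ((2 * H - 1) * n%:R))) ?pow2_gt0//.
  apply: le_trans h; rewrite /s -pow2n mulrAC mulrA -!pow2D.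
  rewrite [X in 2 `^ X](_ : _ = 0) ?powRr0 ?mul1r//.
  ring.
have p2 : 0 <= p / 2 by rewrite divr_ge0// ltW.
have := sum_powR_ge c0 M0 p2 aM lo.
have -> : \sum_(0 <= k < 2 ^ n) (dyadic_increment x n k ^+ 2) `^ (p / 2) = pvariation x p n.
  rewrite pvariationE; apply: eq_bigr => k _.
  by rewrite -[dyadic_increment x n k ^+ 2]real_normK ?num_real// -powR_mulrn// -powRrM mulrC divfK.
apply: le_trans; rewrite le_eqVlt; apply/orP; left; apply/eqP.
have -> : s / 2 / 2 = s / 4 by lra.
have -> : (s / 4) `^ (p / 2) = 2 `^ (- (p * H * n%:R)) * (4^-1) `^ (p / 2).
  by rewrite powRM ?(ltW s0)// /s -powRrM; congr (_ `^ _ * _); field.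
rewrite natrX -pow2n /D /M powR_mulrn//.
have -> : (2 : R) `^ ((1 - p * H) * n%:R) = 2 `^ n%:R * 2 `^ (- (p * H * n%:R)).
  by rewrite -pow2D; congr (_ `^ _); ring.
by field; rewrite !gt_eqF.
Unshelve. all: by end_near. Qed.

Hypothesis cx : {within `[0, 1], continuous x}.

(** The two bounds on the variations decide the limit on either side of [H^-1],
    since the exponential beats the polynomial. *)
Lemma path_roughness_exponent : roughness_exponent x H.
Proof.
have [H0 H1] := andP hH; split => //.
- have [n _ hn] := near_qv.
  have /contrapT nk : ~ ~ exists2 k, (k < 2 ^ n)%N & dyadic_increment x n k != 0.
    move=> hk; have := hn n (leqnn n); rewrite /quadratic_variation big1_seq.
      by rewrite mulr0; lra.
    move=> k; rewrite mem_index_iota => /andP[_ kn].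
    have [->|k0] := eqVneq (dyadic_increment x n k) 0; first by rewrite expr0n.
    by exfalso; apply: hk; exists k.
  have [k kn] := nk; rewrite /dyadic_increment subr_eq0 => hx.
  exists (k.+1%:R / 2 ^+ n), (k%:R / 2 ^+ n); split => //.
  + by rewrite divr_ge0 ?exprn_ge0//= ler_pdivrMr ?exprn_gt0// mul1r -natrX ler_nat.
  + by rewrite divr_ge0 ?exprn_ge0//= ler_pdivrMr ?exprn_gt0// mul1r -natrX ler_nat ltnW.
exists (H^-1)%:E; split.
- by rewrite lee_fin invf_ge1// ltW.
- by rewrite inver gt_eqF ?invr_gt0// invrK.
- move=> p; rewrite lte_fin => Hp.
  have p0 : 0 < p by apply: lt_trans Hp; rewrite invr_gt0.
  have pH : 0 < p * H - 1 by rewrite subr_gt0 -ltr_pdivrMr// div1r.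
  apply: (@squeeze_cvgr _ _ _ _ (cst 0)
    (fun n => C `^ p * (n.+1%:R `^ p * 2 `^ (- (p * H - 1) * n%:R)))).
  + near=> n; rewrite pvariation_le ?(ltW p0)// andbT.
    by apply: sumr_ge0 => k _; exact: powR_ge0.
  + exact: cvg_cst.
  + rewrite -[X in _ --> X](mulr0 (C `^ p)).
    by apply: cvgM; [exact: cvg_cst | exact: cvg_poly_exp].
- move=> p p0; rewrite lte_fin => Hp.
  have pH : 0 < 1 - p * H by rewrite subr_gt0 -ltr_pdivlMr// div1r.
  have [D D0 hD] := pvariation_ge p0.
  apply/cvgryPge => A.
  have := cvgy_exp_poly 2 pH => /cvgryPge /(_ (A / D)) hA.
  near=> n; apply: (@le_trans _ _ (D * (2 `^ ((1 - p * H) * n%:R) / n.+1%:R `^ 2))).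
    by rewrite mulrC -ler_pdivrMr//; near: n; exact: hA.
  by near: n.
Unshelve. all: by end_near. Qed.

(** The estimator is [H] up to the logarithm of the normalised squared norm, and
    the logarithm is Lipschitz near one. *)
Lemma near_rough_estimator : \forall n \near \oo,
  `|rough_estimator x n - H| <= (kap + 1) / ln 2 * (fluctuation H n / n%:R).
Proof.
have l2 : 0 < ln 2 :> R by rewrite ln_gt0// ltr1n.
near=> n.
have n0 : (0 : R) < n%:R by rewrite ltr0n; near: n; exact: nbhs_infty_gt.
have hb : scale H n / 2 <= fs_norm x n ^+ 2 <= 2 * scale H n.
  by near: n; exact: (near_fs_norm_bounds hH C1 modulus concentrated).
have hd : `|fs_norm x n ^+ 2 / scale H n - 1| <= (kap + 1) * fluctuation H n.
  by near: n; exact: (near_fs_norm hH C1 modulus concentrated).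
have s0 := scale_gt0 H n; have [lo hi] := andP hb.
set y := fs_norm x n ^+ 2 / scale H n in hd.
have y0 : 2^-1 <= y by rewrite /y ler_pdivlMr// mulrC.
have yp : 0 < y by apply: lt_le_trans y0; rewrite invr_gt0.
have fp : 0 < fs_norm x n.
  rewrite lt_neqAle fs_ge0 andbT eq_sym; apply: contraTneq yp => f0.
  by rewrite /y f0 expr0n mul0r ltxx.
have lny : `|ln y| <= 2 * `|y - 1|.
  have lnle (z : R) : 0 < z -> ln z <= z - 1.
    by move=> z0; rewrite -{1}(subrK 1 z) addrC; apply: le_ln1Dx; lra.
  have u := lnle _ yp; have v := lnle y^-1.
  rewrite invr_gt0 lnV ?posrE// in v; have {}v := v yp.
  have vy : y^-1 - 1 <= 2 * `|y - 1|.
    have -> : y^-1 - 1 = (1 - y) / y by field; rewrite gt_eqF.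
    rewrite ler_pdivrMr//; have := ler_norm (1 - y); rewrite distrC.
    by have := normr_ge0 (y - 1); nra.
  have := ler_norm (y - 1); have := normr_ge0 (y - 1).
  by rewrite ler_norml; lra.
have -> : rough_estimator x n - H = - (ln y / (2 * ln 2 * n%:R)).
  rewrite /rough_estimator /log2 /y ln_div ?posrE ?exprn_gt0// lnXn// -mulr_natr.
  rewrite /scale ln_powR; field; rewrite gt_eqF// gt_eqF//.
have k0 : 0 < 2 * ln 2 * n%:R :> R by rewrite !mulr_gt0.
rewrite normrN normrM (gtr0_norm (_ : 0 < (2 * ln 2 * n%:R)^-1)) ?invr_gt0//.
rewrite ler_pdivrMr//.
have -> : (kap + 1) / ln 2 * (fluctuation H n / n%:R) * (2 * ln 2 * n%:R) =
    2 * ((kap + 1) * fluctuation H n) by field; rewrite !gt_eqF.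
by apply: (le_trans lny); lra.
Unshelve. all: by end_near. Qed.

Lemma path_consistent : rough_estimator x n @[n --> \oo] --> H.
Proof.
apply/subr_cvg0; apply: norm_cvg0.
apply: (@squeeze_cvgr _ _ _ _ (cst 0)
  (fun n => (kap + 1) / ln 2 * (fluctuation H n * n%:R^-1))).
- by near=> n; rewrite normr_ge0/=; near: n; exact: near_rough_estimator.
- exact: cvg_cst.
- have h : fluctuation H n * n%:R^-1 @[n --> \oo] --> 0.
    rewrite -[X in _ --> X](mulr0 0).
    by apply: cvgM; [exact: cvg_fluctuation | exact: cvg_invn].
  rewrite -[X in _ --> X](mulr0 ((kap + 1) / ln 2)).
  by apply: cvgM; [exact: cvg_cst | exact: h].
Unshelve. all: by end_near. Qed.

(** The two sides agree except at [H = 2^-1], where the rate is larger by a factor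
    [Num.sqrt n]. *)
Let near_rate : \forall n \near \oo,
  0 < rate H n /\ fluctuation H n / n%:R <= rate H n.
Proof.
near=> n.
have n1 : (1 < n)%N by near: n; exact: nbhs_infty_gt.
have n0 : (0 : R) < n%:R by rewrite ltr0n ltnW.
have q0 : 0 < Num.sqrt (ln n%:R) :> R by rewrite sqrtr_gt0 ln_gt0// ltr1n.
rewrite /rate /fluctuation /hurst_gap.
have [h|h|h] := ltgtP H 2^-1.
- have -> : Num.min 2^-1 (1 - H) = 2^-1 :> R by apply/min_idPl; lra.
  split; first by rewrite !mulr_gt0 ?pow2_gt0 ?invr_gt0.
  by rewrite mulrAC mulNr [2^-1 * _]mulrC.
- have -> : Num.min 2^-1 (1 - H) = 1 - H :> R by apply/min_idPr; lra.
  split; first by rewrite !mulr_gt0 ?pow2_gt0 ?invr_gt0.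
  by rewrite mulrAC opprB.
- have -> : Num.min 2^-1 (1 - H) = 2^-1 :> R by apply/min_idPl; lra.
  split; first by rewrite !mulr_gt0 ?pow2_gt0 ?powR_gt0.
  rewrite mulrAC mulNr [2^-1 * _]mulrC; apply: ler_wpM2r; first exact: ltW.
  apply: ler_wpM2l; first exact: powR_ge0.
  by rewrite -[n%:R^-1](powR_inv1 (ler0n R n)); apply: ler_powR; rewrite ?ler1n ?(ltnW n1)//; lra.
Unshelve. all: by end_near. Qed.

Lemma path_rate : 0 <= kap ->
  (limn_esup (fun n => (`|rough_estimator x n - H| / rate H n)%:E)
   <= ((kap + 1) / ln 2)%:E)%E.
Proof.
move=> k0; have l2 : 0 < ln 2 :> R by rewrite ln_gt0// ltr1n.
have : \forall n \near \oo,
    ((`|rough_estimator x n - H| / rate H n)%:E <= ((kap + 1) / ln 2)%:E)%E.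
  near=> n.
  have [r0 rf] : 0 < rate H n /\ fluctuation H n / n%:R <= rate H n.
    by near: n; exact: near_rate.
  rewrite lee_fin ler_pdivrMr//.
  apply: (@le_trans _ _ ((kap + 1) / ln 2 * (fluctuation H n / n%:R))).
    by near: n; exact: near_rough_estimator.
  by apply: ler_wpM2l => //; rewrite divr_ge0 ?addr_ge0// ltW.
move=> [N _ hN]; apply: (@le_trans _ _ (ereal_sup
  [set (`|rough_estimator x n - H| / rate H n)%:E | n in [set n | (N <= n)%N]])).
  by apply: ereal_inf_lbound; exists [set n | (N <= n)%N] => //; exists N.
by apply: ge_ereal_sup => _ [n Nn <-]; exact: hN.
Unshelve. all: by end_near. Qed.

End consequences.

(** * Covariance of the increments of fractional Brownian motion *)

Section powers.
Context {R : realType}.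
Implicit Types p y u v : R.

Lemma powR_midpoint_convex p u v : 1 <= p -> 0 <= u -> 0 <= v ->
  2 * ((u + v) / 2) `^ p <= u `^ p + v `^ p.
Proof.
move=> p1 u0 v0; have h1 : (2^-1 : R) <= 1 by lra.
have h0 : (0 : R) <= 2^-1 by lra.
have h : (2^-1 * u + (1 - 2^-1) * v) `^ p <= 2^-1 * u `^ p + (1 - 2^-1) * v `^ p.
  by apply: (convex_powR p1 (Itv01 h0 h1)); rewrite inE/= in_itv/= ?u0 ?v0.
move: h; have -> : 2^-1 * u + (1 - 2^-1) * v = (u + v) / 2 by field.
lra.
Qed.

(** The convex case for the inverse power. *)
Lemma powR_midpoint_concave p u v : 0 < p <= 1 -> 0 <= u -> 0 <= v ->
  u `^ p + v `^ p <= 2 * ((u + v) / 2) `^ p.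
Proof.
move=> /andP[p0 p1] u0 v0.
have pV1 : 1 <= p^-1 by rewrite invf_ge1.
have back w : 0 <= w -> (w `^ p) `^ p^-1 = w.
  by move=> w0; rewrite -powRrM divff ?gt_eqF// powRr1.
have := powR_midpoint_convex pV1 (powR_ge0 u p) (powR_ge0 v p).
rewrite !back// => h.
have m0 : 0 <= (u `^ p + v `^ p) / 2 by rewrite divr_ge0 ?addr_ge0 ?powR_ge0.
have : ((u `^ p + v `^ p) / 2) `^ p^-1 <= (u + v) / 2 by lra.
move=> /(ge0_ler_powR (ltW p0)); rewrite !nnegrE powR_ge0 divr_ge0 ?addr_ge0//.
move=> /(_ isT isT).
by rewrite -powRrM mulVf ?gt_eqF// powRr1//; lra.
Qed.

(** For [p < 1] the mean value theorem gives nothing near [y = 1]; comparison with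
    the exponent [2] treats all [p] at once. *)
Lemma powR_increment p y : 0 < p < 2 -> 1 <= y ->
  0 <= y `^ p - (y - 1) `^ p <= 2 * y `^ (p - 1).
Proof.
move=> /andP[p0 p2] y1; have y0 : 0 < y by lra.
apply/andP; split.
  by rewrite subr_ge0; apply: ge0_ler_powR; rewrite ?nnegrE ?(ltW p0)//; lra.
have q0 : 0 <= 1 - y^-1 by rewrite subr_ge0 invf_le1.
have -> : y - 1 = y * (1 - y^-1) by rewrite mulrBr mulr1 divff// gt_eqF.
rewrite powRM ?(ltW y0)// -{1}(mulr1 (y `^ p)) -mulrBr.
have -> : 2 * y `^ (p - 1) = y `^ p * (2 / y).
  rewrite powRD; last by rewrite (gt_eqF y0) implybT.
  by rewrite powR_inv1 ?(ltW y0)//; ring.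
apply: ler_wpM2l; first exact: powR_ge0.
(* the exponent [2] is enough since the base is at most one *)
suff : (1 - y^-1) ^+ 2 <= (1 - y^-1) `^ p.
  by have := sqr_ge0 y^-1; move: (y^-1) => z; nra.
have [->|z0] := eqVneq (1 - y^-1) 0; first by rewrite expr0n/= powR_ge0.
rewrite -powR_mulrn//; apply: ger_powR; last exact: ltW.
rewrite lt_neqAle eq_sym z0 q0/=.
by rewrite lerBlDr lerDl invr_ge0 ltW.
Qed.

End powers.

Section increment_covariance.
Context {R : realType}.
Variables (H : R) (hH : 0 < H < 1).
Implicit Types (y : R) (N k l : nat).

Local Notation p := (2 * H).
Let p02 : 0 < p < 2. Proof. by case/andP: hH; lra. Qed.
Let p0 : 0 < p. Proof. by case/andP: p02. Qed.

Definition fbm_cov (s t : R) : R :=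
  (s `^ p + t `^ p - `|t - s| `^ p) / 2.

(** Up to scaling, the covariance of two increments of unit length at distance
    [y]. *)
Definition second_difference y : R :=
  `|y + 1| `^ p + `|y - 1| `^ p - 2 * `|y| `^ p.

Lemma second_differenceN y : second_difference (- y) = second_difference y.
Proof.
rewrite /second_difference normrN -(normrN (y + 1)) -(normrN (y - 1)) !opprD opprK.
ring.
Qed.

Lemma second_difference0 : second_difference 0 = 2.
Proof.
rewrite /second_difference normr0 powR0 ?gt_eqF// add0r sub0r normrN normr1 powR1.
ring.
Qed.

Let second_difference_ge1 y : 1 <= y -> second_difference y =
  (y + 1) `^ p + (y - 1) `^ p - 2 * ((y + 1 + (y - 1)) / 2) `^ p.
Proof.
move=> y1; rewrite /second_difference !ger0_norm; [|lra..].
by have -> : (y + 1 + (y - 1)) / 2 = y by field.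
Qed.

Let second_difference_normE y : second_difference `|y| = second_difference y.
Proof.
have [y0|y0] := leP 0 y; first by rewrite ger0_norm.
by rewrite ltr0_norm// second_differenceN.
Qed.

Lemma second_difference_le0 y : H <= 2^-1 -> 1 <= `|y| -> second_difference y <= 0.
Proof.
move=> H2 y1; rewrite -second_difference_normE second_difference_ge1// subr_le0.
apply: powR_midpoint_concave; last 2 first; [lra | lra |].
by rewrite p0; lra.
Qed.

Lemma second_difference_ge0 y : 2^-1 <= H -> 1 <= `|y| -> 0 <= second_difference y.
Proof.
move=> H2 y1; rewrite -second_difference_normE second_difference_ge1// subr_ge0.
by apply: powR_midpoint_convex; lra.
Qed.

(** The row sums telescope: they are covariances with the total increment. *)
Lemma sum_second_difference N k : (k < N)%N ->
  \sum_(0 <= l < N) second_difference (l%:R - k%:R) =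
  ((N%:R - k%:R) `^ p - (N%:R - k%:R - 1) `^ p) +
  (k.+1%:R `^ p - k%:R `^ p).
Proof.
move=> kN; pose g l : R := `|l%:R - k%:R| `^ p - `|l%:R - k%:R - 1| `^ p.
have gE l : second_difference (l%:R - k%:R) = g l.+1 - g l.
  rewrite /second_difference /g -(natr1 l).
  have -> : l%:R + 1 - k%:R - 1 = l%:R - k%:R :> R by lra.
  have -> : l%:R + 1 - k%:R = l%:R - k%:R + 1 :> R by lra.
  ring.
under eq_bigr do rewrite gE.
rewrite telescope_sumr// /g.
have kN1 : (k.+1%:R <= N%:R :> R) by rewrite ler_nat.
rewrite -(natr1 k) in kN1 *.
rewrite (@ger0_norm _ (N%:R - k%:R)); last by lra.
rewrite (@ger0_norm _ (N%:R - k%:R - 1)); last by lra.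
rewrite sub0r normrN ger0_norm ?ler0n//.
have -> : - k%:R - 1 = - (k%:R + 1) :> R by lra.
by rewrite normrN ger0_norm; [ring | rewrite addr_ge0].
Qed.

(** Off the diagonal the covariances have one sign, given by the concavity or
    the convexity of the variance. *)
Lemma sum_norm_second_difference N k : (k < N)%N ->
  \sum_(0 <= l < N) `|second_difference (l%:R - k%:R)| <=
  4 * Num.max 1 (N%:R `^ (p - 1)).
Proof.
move=> kN; have N1 : 1 <= N%:R :> R by rewrite ler1n (leq_ltn_trans _ kN).
have offdiag l : l != k -> 1 <= `|l%:R - k%:R : R|.
  move=> lk; have [kl|kl|kl] := ltngtP k l; last by rewrite kl eqxx in lk.
  - have : (k.+1%:R <= l%:R :> R) by rewrite ler_nat.
    rewrite -(natr1 k) => h; rewrite ger0_norm; lra.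
  - have : (l.+1%:R <= k%:R :> R) by rewrite ler_nat.
    rewrite -(natr1 l) => h; rewrite distrC ger0_norm; lra.
have kN1 : (k.+1%:R <= N%:R :> R) by rewrite ler_nat.
have k1 : 1 <= N%:R - k%:R :> R by move: kN1; rewrite -(natr1 k); lra.
have k2 : 1 <= k.+1%:R :> R by rewrite ler1n.
have e : k.+1%:R - 1 = k%:R :> R by rewrite -(natr1 k) addrK.
have /andP[l1 u1] := powR_increment p02 k1.
have /andP[] := powR_increment p02 k2; rewrite e => l2 u2.
have [H2|H2] := leP H 2^-1.
- apply: (@le_trans _ _ 4); last by rewrite -[leLHS]mulr1 ler_pM2l// le_max lexx.
  have nE l : `|second_difference (l%:R - k%:R)| =
      (if l == k then 4 else 0) - second_difference (l%:R - k%:R).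
    have [->|lk] := eqVneq l k; first by rewrite subrr second_difference0 ger0_norm//; ring.
    by rewrite ler0_norm ?sub0r// second_difference_le0// offdiag.
  under eq_bigr do rewrite nE.
  rewrite sumrB sum_second_difference//.
  have -> : \sum_(0 <= l < N) (if l == k then 4 else 0) = 4 :> R.
    by rewrite big_mkord (bigD1 (Ordinal kN))//= eqxx big1 ?addr0// => i ik;
       rewrite (negbTE (_ : (i : nat) != k)).
  by lra.
- have nE l : `|second_difference (l%:R - k%:R)| = second_difference (l%:R - k%:R).
    rewrite ger0_norm//; have [->|lk] := eqVneq l k.
      by rewrite subrr second_difference0.
    by apply: second_difference_ge0; [exact: ltW | exact: offdiag].
  under eq_bigr do rewrite nE.
  rewrite sum_second_difference//.
  have q0 : 0 <= p - 1 by lra.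
  have mono y : 0 <= y -> y <= N%:R -> y `^ (p - 1) <= N%:R `^ (p - 1).
    by move=> y0 yN; apply: ge0_ler_powR; rewrite ?nnegrE.
  have m1 : (N%:R - k%:R) `^ (p - 1) <= N%:R `^ (p - 1).
    by apply: mono; [lra | rewrite gerBl].
  have m2 := mono _ (ler0n _ _) kN1.
  apply: (@le_trans _ _ (4 * N%:R `^ (p - 1))); first by lra.
  by rewrite ler_pM2l// le_max lexx orbT.
Qed.

Definition increment_cov (s t s' t' : R) : R :=
  fbm_cov t t' - fbm_cov t s' - fbm_cov s t' + fbm_cov s s'.

Lemma increment_covE (N k l : nat) : (0 < N)%N ->
  increment_cov (k%:R / N%:R) (k.+1%:R / N%:R) (l%:R / N%:R) (l.+1%:R / N%:R) =
  N%:R `^ (- p) / 2 * second_difference (l%:R - k%:R).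
Proof.
move=> N0; have Np : 0 < N%:R :> R by rewrite ltr0n.
have sc u v : `|u / N%:R - v / N%:R| `^ p = N%:R `^ (- p) * `|u - v| `^ p.
  rewrite -mulrBl normrM powRM// mulrC (gtr0_norm (_ : 0 < N%:R^-1)) ?invr_gt0//.
  by rewrite powRV ?ltW// powRN.
rewrite /increment_cov /fbm_cov !sc /second_difference -(natr1 k) -(natr1 l).
have -> : l%:R + 1 - (k%:R + 1) = l%:R - k%:R :> R by lra.
have -> : l%:R - (k%:R + 1) = l%:R - k%:R - 1 :> R by lra.
have -> : l%:R + 1 - k%:R = l%:R - k%:R + 1 :> R by lra.
by field.
Qed.

End increment_covariance.

Section fbm_moments.
Context {R : realType} {d : measure_display} {T : measurableType d}.
Variables (P : probability T R) (H : R) (B : R -> {RV P >-> R}).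
Hypothesis hB : fractional_brownian_motion H B.

Let gB : gaussian_process01 B. Proof. by case: hB. Qed.

Let EB t : 0 <= t <= 1 -> (\int[P]_w (B t w)%:E = 0)%E.
Proof. by case: hB => _ h _ _ /h; rewrite unlock. Qed.

Let mB t : measurable_fun setT (B t).
Proof. exact: measurable_funPT. Qed.

Let gaussianB t : 0 <= t <= 1 -> gaussian P (B t).
Proof.
move=> t01; have := gB (fun=> 1) (t := fun _ : 'I_1 => t) (fun=> t01).
have -> // : (fun w => \sum_(i < 1) 1 * B t w) = B t.
by apply/funext => w; rewrite big_ord1 mul1r.
Qed.

Let iB2 t : 0 <= t <= 1 -> P.-integrable setT (fun w => (B t w ^+ 2)%:E).
Proof.
move=> t01; have [s [E2 _ _]] := gaussian_centered (mB t) (gaussianB t01) (EB t01).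
apply/integrableP; split.
  by apply/measurable_EFinP; apply: measurable_funX.
under eq_integral do rewrite /= ger0_norm ?sqr_ge0//.
by rewrite E2 ltry.
Qed.

Let iBB s t : 0 <= s <= 1 -> 0 <= t <= 1 ->
  P.-integrable setT (fun w => (B s w * B t w)%:E).
Proof.
move=> s01 t01.
apply: (@le_integrable _ _ _ P setT measurableT _
  (fun w => (B s w ^+ 2)%:E + (B t w ^+ 2)%:E)%E) => //.
- by apply/measurable_EFinP; apply: measurable_funM.
- move=> w _ /=; rewrite lee_fin ler_normr; apply/orP; left.
  rewrite normrM -(real_normK (num_real (B s w))) -(real_normK (num_real (B t w))).
  have := sqr_ge0 (`|B s w| - `|B t w|); have := normr_ge0 (B s w).
  have := normr_ge0 (B t w); nra.
- by apply: integrableD => //; exact: iB2.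
Qed.

Let iB t : 0 <= t <= 1 -> P.-integrable setT (EFin \o B t).
Proof.
move=> t01; apply: (@le_integrable _ _ _ P setT measurableT _
  (fun w => 1%:E + (B t w ^+ 2)%:E)%E) => //.
- exact/measurable_EFinP.
- move=> w _ /=; rewrite lee_fin ler_normr; apply/orP; left.
  rewrite -(real_normK (num_real (B t w))).
  have := sqr_ge0 (`|B t w| - 1); have := normr_ge0 (B t w); nra.
- by apply: integrableD => //; [exact: finite_measure_integrable_cst | exact: iB2].
Qed.

Let EBB s t : 0 <= s <= 1 -> 0 <= t <= 1 ->
  (\int[P]_w (B s w * B t w)%:E = (fbm_cov H s t)%:E)%E.
Proof.
move=> s01 t01; case: hB => _ EE cov _; rewrite /fbm_cov -cov//.
rewrite unlock !EE//= unlock; apply: eq_integral => w _ /=.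
by rewrite fctE/= !subr0.
Qed.

Variables (n : nat) (t a : 'I_n -> R).
Hypothesis t01 : forall i, 0 <= t i <= 1.

Local Notation Z := (fun w => \sum_(i < n) a i * B (t i) w).

Lemma measurable_fbm_sum : measurable_fun setT Z.
Proof. by apply: measurable_sum => i; exact: measurable_funM. Qed.

(** A linear combination of values is Gaussian and centred, so its Laplace
    transform and its characteristic function are given by its variance. *)
Lemma fbm_sum_moments : let v := \sum_(i < n) \sum_(j < n) a i * a j * fbm_cov H (t i) (t j) in
  [/\ 0 <= v, (\int[P]_w (expR (Z w))%:E = (expR (v / 2))%:E)%E &
    (\int[P]_w (cos (Z w))%:E = (expR (- (v / 2)))%:E)%E].
Proof.
move=> v.
have EZ : (\int[P]_w (Z w)%:E = 0)%E.
  under eq_integral do rewrite -sumEFin.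
  rewrite integral_sum//; last first.
    by move=> i; under eq_fun do rewrite EFinM; apply: integrableZl => //; exact: iB.
  rewrite big1// => i _; under eq_integral do rewrite EFinM.
  by rewrite integralZl//; [rewrite EB ?mule0 | exact: iB].
have EZ2 : (\int[P]_w (Z w ^+ 2)%:E = v%:E)%E.
  have e w : Z w ^+ 2 = \sum_(i < n) \sum_(j < n) a i * a j * (B (t i) w * B (t j) w).
    rewrite expr2 mulr_suml; apply: eq_bigr => i _; rewrite mulr_sumr.
    by apply: eq_bigr => j _; ring.
  under eq_integral do rewrite e -sumEFin.
  have iij i j : P.-integrable setT (fun w => (a i * a j * (B (t i) w * B (t j) w))%:E).
    by under eq_fun do rewrite EFinM; apply: integrableZl => //; exact: iBB.
  rewrite integral_sum//; last first.
    by move=> i; under eq_fun do rewrite -sumEFin; apply: integrable_sum => // j _; exact: iij.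
  rewrite /v -sumEFin; apply: eq_bigr => i _.
  under eq_integral do rewrite -sumEFin.
  rewrite integral_sum//.
  rewrite -sumEFin; apply: eq_bigr => j _; under eq_integral do rewrite EFinM.
  by rewrite integralZl//; [rewrite EBB// -EFinM | exact: iBB].
have [s [E2 Eexp Ecos]] := gaussian_centered measurable_fbm_sum (gB a t01) EZ.
have vs : v = s ^+ 2 by move: E2; rewrite EZ2; case.
by rewrite vs; split => //; exact: sqr_ge0.
Qed.

End fbm_moments.

(** * Concentration of the quadratic variation *)

Section dyadic_level.
Context {R : realType} {d : measure_display} {T : measurableType d}.
Variables (P : probability T R) (H : R) (B : R -> {RV P >-> R}).
Hypothesis hH : 0 < H < 1.
Hypothesis hB : fractional_brownian_motion H B.
Variable n : nat.

Local Notation N := (2 ^ n)%N.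
Local Notation p := (2 * H).

Let sigma : R := 2 `^ ((H - 2^-1) * n%:R).

Let sigma2 : sigma ^+ 2 = 2 `^ ((2 * H - 1) * n%:R).
Proof. by rewrite pow2X; congr (_ `^ _); field. Qed.

Let Np q : N%:R `^ q = 2 `^ (q * n%:R) :> R.
Proof. by rewrite natrX -pow2n -powRrM mulrC. Qed.

(** Increments of level [n], scaled to have total variance one. *)
Definition scaled_combination (u : 'rV[R]_N) (w : T) : R :=
  \sum_(k < N) u 0 k * (sigma * dyadic_increment (B ^~ w) n k).

Let C (k l : nat) : R :=
  sigma ^+ 2 * (N%:R `^ (- p) / 2 * second_difference H (l%:R - k%:R)).

Definition scaled_cov (u v : 'rV[R]_N) : R :=
  \sum_(k < N) \sum_(l < N) u 0 k * v 0 l * C k l.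

Definition level_basis (i : nat) : 'rV[R]_N := \row_k (i == k :> nat)%:R.

(** A bound on the norm of the covariance matrix of the scaled increments. *)
Definition level_norm : R := 2 * 2 `^ (- (2 * hurst_gap H) * n%:R).

Let Csym k l : C k l = C l k.
Proof. by rewrite /C -[in LHS]second_differenceN opprB. Qed.

Let dyadic01 (k : nat) : (k <= N)%N -> 0 <= (k%:R / 2 ^+ n : R) <= 1.
Proof.
move=> kN; rewrite divr_ge0 ?exprn_ge0//= ler_pdivrMr ?exprn_gt0// mul1r.
by rewrite -natrX ler_nat.
Qed.

Let covC (k l : nat) : sigma ^+ 2 * increment_cov H (k%:R / 2 ^+ n) (k.+1%:R / 2 ^+ n)
  (l%:R / 2 ^+ n) (l.+1%:R / 2 ^+ n) = C k l.
Proof. by rewrite /C -natrX increment_covE ?expn_gt0. Qed.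

Lemma scaled_combination_moments u :
  [/\ 0 <= scaled_cov u u,
    (\int[P]_w (expR (scaled_combination u w))%:E = (expR (scaled_cov u u / 2))%:E)%E &
    (\int[P]_w (cos (scaled_combination u w))%:E =
     (expR (- (scaled_cov u u / 2)))%:E)%E].
Proof.
(* right end points first, then left end points with the opposite sign *)
pose t (i : 'I_(N + N)) : R := match fintype.split i with
  | inl k => k.+1%:R / 2 ^+ n | inr k => k%:R / 2 ^+ n end.
pose a (i : 'I_(N + N)) : R := match fintype.split i with
  | inl k => sigma * u 0 k | inr k => - (sigma * u 0 k) end.
have tl k : t (lshift N k) = k.+1%:R / 2 ^+ n by rewrite /t (unsplitK (inl _)).
have tr k : t (rshift N k) = k%:R / 2 ^+ n by rewrite /t (unsplitK (inr _)).
have al k : a (lshift N k) = sigma * u 0 k by rewrite /a (unsplitK (inl _)).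
have ar k : a (rshift N k) = - (sigma * u 0 k) by rewrite /a (unsplitK (inr _)).
have t01 i : 0 <= t i <= 1.
  by rewrite /t; case: fintype.split => k; apply: dyadic01 => //; exact: ltnW.
have [v0 Ee Ec] := fbm_sum_moments hB a t01.
have eZ w : \sum_(i < N + N) a i * B (t i) w = scaled_combination u w.
  rewrite big_split_ord/= -big_split/=; apply: eq_bigr => k _.
  by rewrite tl tr al ar /dyadic_increment; ring.
have ev : \sum_(i < N + N) \sum_(j < N + N) a i * a j * fbm_cov H (t i) (t j) =
    scaled_cov u u.
  rewrite big_split_ord/= -big_split/=; apply: eq_bigr => k _.
  rewrite !big_split_ord/= addrACA -!big_split/=; apply: eq_bigr => l _.
  rewrite !tl !tr !al !ar -covC /increment_cov; ring.
rewrite ev in v0 Ee Ec; split => //.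
- by rewrite -Ee; apply: eq_integral => w _; rewrite eZ.
- by rewrite -Ec; apply: eq_integral => w _; rewrite eZ.
Qed.

Lemma measurable_scaled_combination u : measurable_fun setT (scaled_combination u).
Proof.
apply: measurable_sum => k; apply: measurable_funM => //; apply: measurable_funM => //.
by apply: measurable_funB; exact: measurable_funPT.
Qed.

Lemma scaled_combination_linear a u v w : scaled_combination (a *: u + v) w =
  a * scaled_combination u w + scaled_combination v w.
Proof.
rewrite /scaled_combination mulr_sumr -big_split/=; apply: eq_bigr => k _.
by rewrite !mxE; ring.
Qed.

Lemma symmetric_scaled_cov : symmetric_form scaled_cov.
Proof.
split=> [u v|a u v w].
  rewrite /scaled_cov exchange_big/=; apply: eq_bigr => l _; apply: eq_bigr => k _.
  by rewrite Csym (mulrC (u 0 k)).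
rewrite /scaled_cov mulr_sumr -big_split/=; apply: eq_bigr => k _.
rewrite mulr_sumr -big_split/=; apply: eq_bigr => l _.
by rewrite !mxE; ring.
Qed.

Lemma level_norm_gt0 : 0 < level_norm.
Proof. by rewrite mulr_gt0// pow2_gt0. Qed.

(** The maximum in the bound on the row sums is what makes [hurst_gap] a
    minimum. *)
Let row_sum (k : 'I_N) : \sum_(l < N) `|C k l| <= level_norm.
Proof.
have [H0 H1] := andP hH.
have n0 : 0 <= n%:R :> R by [].
have c0 : 0 <= sigma ^+ 2 * (N%:R `^ (- p) / 2) :> R.
  by rewrite mulr_ge0 ?sqr_ge0// divr_ge0 ?powR_ge0.
have -> : \sum_(l < N) `|C k l| = sigma ^+ 2 * (N%:R `^ (- p) / 2) *
    \sum_(0 <= l < N) `|second_difference H (l%:R - k%:R)|.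
  rewrite big_mkord mulr_sumr; apply: eq_bigr => l _.
  by rewrite /C mulrA normrM ger0_norm.
have := sum_norm_second_difference hH (ltn_ord k).
move=> /(ler_wpM2l c0) h; apply: (le_trans h).
rewrite sigma2 !Np /level_norm.
have -> : 2 `^ ((2 * H - 1) * n%:R) * (2 `^ (- p * n%:R) / 2) *
    (4 * Num.max 1 (2 `^ ((p - 1) * n%:R))) =
    2 * (2 `^ (- n%:R) * Num.max 1 (2 `^ ((p - 1) * n%:R))) :> R.
  have -> : (2 : R) `^ (- n%:R) = 2 `^ ((2 * H - 1) * n%:R) * 2 `^ (- p * n%:R).
    by rewrite -pow2D; congr (_ `^ _); ring.
  by field.
apply: ler_wpM2l => //.
rewrite maxr_pMr ?powR_ge0// mulr1 -pow2D ge_max.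
rewrite /hurst_gap; apply/andP; split; apply: pow2_le.
- have : Num.min 2^-1 (1 - H) <= 2^-1 by rewrite ge_min lexx.
  by move: (Num.min _ _) => m hm; rewrite -subr_ge0 (_ : _ - _ = (1 - 2 * m) * n%:R);
    [apply: mulr_ge0 => //; lra | ring].
- have : Num.min 2^-1 (1 - H) <= 1 - H by rewrite ge_min lexx orbT.
  by move: (Num.min _ _) => m hm; rewrite -subr_ge0 (_ : _ - _ = 2 * (1 - H - m) * n%:R);
    [apply: mulr_ge0 => //; lra | ring].
Qed.

(** Schur's test: a symmetric matrix is bounded by its largest absolute row
    sum. *)
Lemma scaled_cov_le u : scaled_cov u u <= level_norm * \sum_(k < N) u 0 k ^+ 2.
Proof.
have h : scaled_cov u u <= \sum_(k < N) \sum_(l < N)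
    (u 0 k ^+ 2 / 2 * `|C k l| + u 0 l ^+ 2 / 2 * `|C k l|).
  apply: ler_sum => k _; apply: ler_sum => l _.
  apply: (le_trans (ler_norm _)); rewrite normrM -mulrDl; apply: ler_wpM2r => //.
  rewrite normrM -(real_normK (num_real (u 0 k))) -(real_normK (num_real (u 0 l))).
  by have := sqr_ge0 (`|u 0 k| - `|u 0 l|); nra.
apply: (le_trans h).
under eq_bigr do rewrite big_split/=.
rewrite big_split/= [X in _ + X]exchange_big/=.
have -> : \sum_(j < N) \sum_(i < N) u 0 j ^+ 2 / 2 * `|C i j| =
    \sum_(i < N) \sum_(l < N) u 0 i ^+ 2 / 2 * `|C i l|.
  by apply: eq_bigr => k _; apply: eq_bigr => l _; rewrite Csym.
rewrite -mulr2n mulr_sumr -sumrMnl; apply: ler_sum => k _.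
rewrite -mulr_sumr -mulr_natr.
have := row_sum k; move: (\sum_(l < N) _) => S hS.
have := sqr_ge0 (u 0 k); nra.
Qed.

Let basis_comb (j : nat) (tau : nat -> R) (k : 'I_N) :
  (\sum_(i < j) tau i *: level_basis i) 0 k = if (k < j)%N then tau k else 0.
Proof.
rewrite summxE; have [kj|jk] := ltnP k j.
- rewrite (bigD1 (Ordinal kj))//= !mxE eqxx mulr1 big1 ?addr0// => i ik.
  by rewrite !mxE (negbTE (_ : (i : nat) != k)) ?mulr0.
- rewrite big1// => i _; rewrite !mxE.
  by rewrite ltn_eqF ?mulr0// (leq_trans (ltn_ord i)).
Qed.

Lemma scaled_cov_span (j : nat) (tau : nat -> R) : (j <= N)%N ->
  scaled_cov (\sum_(i < j) tau i *: level_basis i)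
             (\sum_(i < j) tau i *: level_basis i) <=
  level_norm * \sum_(i < j) tau i ^+ 2.
Proof.
move=> jN; apply: (le_trans (scaled_cov_le _)).
rewrite ler_pM2l ?level_norm_gt0//.
under eq_bigr do rewrite basis_comb.
rewrite (big_ord_widen N (fun i => tau i ^+ 2) jN) [leRHS]big_mkcond/=.
by apply: ler_sum => k _; case: ifP => // _; rewrite expr0n.
Qed.

Let cov_basis (i : 'I_N) : scaled_cov (level_basis i) (level_basis i) = C i i.
Proof.
rewrite /scaled_cov (bigD1 i)//= (bigD1 i)//= !mxE !eqxx !mul1r.
rewrite [X in _ + X + _]big1 ?addr0; last first.
  by move=> l li; rewrite !mxE (negbTE (_ : (i : nat) != l)) ?mulr0 ?mul0r// eq_sym.
rewrite big1 ?addr0// => k ki; rewrite big1// => l _.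
by rewrite !mxE (negbTE (_ : (i : nat) != k)) ?mul0r// eq_sym.
Qed.

Let Cdiag (k : nat) : C k k = N%:R^-1.
Proof.
rewrite /C subrr (second_difference0 hH) divfK// sigma2 Np -pow2D natrX -pow2n -pow2N.
by congr (_ `^ _); ring.
Qed.

Lemma scaled_cov_basis_le (i : nat) : (i < N)%N ->
  scaled_cov (level_basis i) (level_basis i) <= level_norm.
Proof.
move=> iN; rewrite -[i]/(val (Ordinal iN)) cov_basis.
apply: le_trans (row_sum (Ordinal iN)); rewrite (bigD1 (Ordinal iN))//=.
by rewrite (le_trans (ler_norm _))// lerDl sumr_ge0.
Qed.

Lemma scaled_cov_trace : \sum_(i < N) scaled_cov (level_basis i) (level_basis i) = 1.
Proof.
under eq_bigr do rewrite cov_basis Cdiag.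
by rewrite sumr_const card_ord -[LHS]mulr_natl mulfV// pnatr_eq0 -lt0n expn_gt0.
Qed.

Lemma sum_sqr_scaled w : \sum_(i < N) scaled_combination (level_basis i) w ^+ 2 =
  2 `^ ((2 * H - 1) * n%:R) * quadratic_variation (B ^~ w) n.
Proof.
rewrite /quadratic_variation big_mkord mulr_sumr; apply: eq_bigr => i _.
rewrite /scaled_combination (bigD1 i)//= mxE eqxx mul1r big1 ?addr0.
  by rewrite exprMn sigma2.
by move=> k ki; rewrite mxE (negbTE (_ : (i : nat) != k)) ?mul0r// eq_sym.
Qed.

Lemma fbm_concentration s t : `|s| = 1 -> 0 < t <= 2 ->
  (\int[P]_w (expR (s * t / (16 * level_norm) *
     (2 `^ ((2 * H - 1) * n%:R) * quadratic_variation (B ^~ w) n - 1 - s * t)))%:E <=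
   (expR (- (t ^+ 2 / (32 * level_norm))))%:E)%E.
Proof.
move=> s1 t02.
have c0 u : 0 <= scaled_cov u u by case: (scaled_combination_moments u).
have le u : (\int[P]_w (expR (scaled_combination u w))%:E =
    (expR (scaled_cov u u / 2))%:E)%E by case: (scaled_combination_moments u).
have lc u : (\int[P]_w (cos (scaled_combination u w))%:E =
    (expR (- (scaled_cov u u / 2)))%:E)%E by case: (scaled_combination_moments u).
have := concentration_squares measurable_scaled_combination scaled_combination_linear
  symmetric_scaled_cov c0 level_norm_gt0 scaled_cov_span scaled_cov_basis_le le lc
  s1 t02 scaled_cov_trace.
by under eq_integral do rewrite sum_sqr_scaled.
Qed.

(** An increment of level [n] has standard deviation [2 `^ (- H * n)], so a single
    one, rescaled, is a standard Gaussian. *)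
Lemma increment_mgf (k : nat) (s : R) : (k < N)%N -> `|s| = 1 ->
  (\int[P]_w (expR (s * (2 `^ (H * n%:R) * dyadic_increment (B ^~ w) n k)))%:E =
   (expR 2^-1)%:E)%E.
Proof.
move=> kN s1; have s2 : s ^+ 2 = 1 by rewrite -real_normK ?num_real// s1 expr1n.
pose r := s * 2 `^ (2^-1 * n%:R).
have r2 : r ^+ 2 = N%:R.
  by rewrite exprMn s2 mul1r pow2X natrX -pow2n; congr (_ `^ _); field.
have [_ E _] := scaled_combination_moments (r *: level_basis k).
move: E; have [_ bL] := symmetric_scaled_cov.
have -> : scaled_cov (r *: level_basis k) (r *: level_basis k) = 1.
  have [bC _] := symmetric_scaled_cov.
  have z u : scaled_cov 0 u = 0.
    by have := bL (-1) 0 0 u; rewrite scaler0 addr0; lra.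
  have sc u v : scaled_cov (r *: u) v = r * scaled_cov u v.
    by have := bL r u 0 v; rewrite addr0 z addr0.
  rewrite sc bC sc mulrA -expr2 r2 -[k]/(val (Ordinal kN)) cov_basis Cdiag.
  by rewrite mulfV// pnatr_eq0 -lt0n expn_gt0.
rewrite div1r => <-; apply: eq_integral => w _; congr (expR _)%:E.
rewrite /scaled_combination (bigD1 (Ordinal kN))//= !mxE eqxx mulr1 big1 ?addr0; last first.
  by move=> l lk; rewrite !mxE (negbTE (_ : (k : nat) != l)) ?mulr0 ?mul0r// eq_sym.
have -> : (2 : R) `^ (H * n%:R) = 2 `^ (2^-1 * n%:R) * sigma.
  by rewrite -pow2D; congr (_ `^ _); field.
by rewrite /r; ring.
Qed.

End dyadic_level.

Section summability.
Context {R : realType}.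

Lemma nneseries_lty (v : nat -> R) (K : R) : (forall n, 0 <= v n) ->
  (forall n, \sum_(0 <= i < n) v i <= K) -> (\sum_(n <oo) (v n)%:E < +oo)%E.
Proof.
move=> v0 vK; apply: (@le_lt_trans _ _ K%:E); last exact: ltry.
apply: lime_le.
  by apply: is_cvg_nneseries => n _ _; rewrite lee_fin.
by near=> n; rewrite sumEFin lee_fin.
Unshelve. all: by end_near. Qed.

Lemma sum_half_le (K : R) n : 0 <= K -> \sum_(0 <= i < n) K * 2^-1 ^+ i <= 2 * K.
Proof.
move=> K0; have -> : \sum_(0 <= i < n) K * 2^-1 ^+ i = 2 * K - 2 * K * 2^-1 ^+ n.
  elim: n => [|n IH]; first by rewrite big_nil expr0 mulr1 subrr.
  by rewrite big_nat_recr//= IH exprS; field.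
by rewrite lerBlDr lerDl mulr_ge0 ?exprn_ge0 ?mulr_ge0.
Qed.

(* the term of index zero vanishes because [0^-1 = 0] *)
Lemma sum_inv_mul_succ_le n : \sum_(0 <= i < n) i%:R^-1 * i.+1%:R^-1 <= 1 :> R.
Proof.
case: n => [|n]; first by rewrite big_nil.
have -> : \sum_(0 <= i < n.+1) i%:R^-1 * i.+1%:R^-1 = 1 - n.+1%:R^-1 :> R.
  elim: n => [|n IH]; first by rewrite big_nat1 invr0 mul0r invr1 subrr.
  rewrite big_nat_recr//= IH -(natr1 n.+1).
  have : 0 < n.+1%:R :> R by [].
  by move: n.+1%:R => y y0; field; rewrite !gt_eqF//; lra.
by rewrite lerBlDr lerDl invr_ge0.
Qed.

End summability.

Section fbm_paths.
Context {R : realType} {d : measure_display} {T : measurableType d}.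
Variables (P : probability T R) (H : R) (B : R -> {RV P >-> R}).
Hypothesis hH : 0 < H < 1.
Hypothesis hB : fractional_brownian_motion H B.

Let m_increment n k : measurable_fun setT (fun w => dyadic_increment (B ^~ w) n k).
Proof. by apply: measurable_funB; exact: measurable_funPT. Qed.

(** A union bound over the increments of a level, in exponential form: there are
    [2 ^ n] of them and each of the two tails has mass at most a constant times
    [expR (- (2 * n))], which is at most [4 ^- n]. *)
Lemma fbm_ae_near_modulus : {ae P, forall w, \forall n \near \oo,
  forall k, (k < 2 ^ n)%N ->
  `|2 `^ (H * n%:R) * dyadic_increment (B ^~ w) n k| <= 2 * n%:R}.
Proof.
pose Z n k w := 2 `^ (H * n%:R) * dyadic_increment (B ^~ w) n k : R.
pose W n w := expR (- (2 * n%:R)) *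
  \sum_(k < 2 ^ n) (expR (1 * Z n k w) + expR (-1 * Z n k w)).
have mZ n k s : measurable_fun setT (fun w => expR (s * Z n k w)).
  apply: measurableT_comp => //; apply: measurable_funM => //.
  by apply: measurable_funM => //; exact: m_increment.
have mW n : measurable_fun setT (W n).
  apply: measurable_funM => //; apply: measurable_sum => k.
  by apply: measurable_funD; exact: mZ.
have W0 n w : 0 <= W n w.
  by rewrite mulr_ge0 ?expR_ge0 ?sumr_ge0// => k _; rewrite addr_ge0 ?expR_ge0.
pose K : R := 2 * expR 2^-1.
have K0 : 0 <= K by rewrite mulr_ge0 ?expR_ge0.
have EW n : (\int[P]_w (W n w)%:E <= (K * 2^-1 ^+ n)%:E)%E.
  pose S k w : \bar R := (expR (1 * Z n k w) + expR (-1 * Z n k w))%:E.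
  have mS k : measurable_fun setT (S k).
    by apply/measurable_EFinP; apply: measurable_funD; exact: mZ.
  have S0 k w : (0 <= S k w)%E by rewrite lee_fin addr_ge0 ?expR_ge0.
  have ES k : (k < 2 ^ n)%N -> (\int[P]_w S k w = K%:E)%E.
    move=> kn; rewrite /S; under eq_integral do rewrite EFinD.
    have e0 s w : setT w -> (0 <= (expR (s * Z n k w))%:E)%E.
      by move=> _; rewrite lee_fin expR_ge0.
    have me s : measurable_fun setT (fun w => (expR (s * Z n k w))%:E).
      exact/measurable_EFinP.
    rewrite (ge0_integralD _ _ (e0 1) (me 1) (e0 (-1)) (me (-1)))//.
    rewrite /Z !(increment_mgf hH hB)// ?normrN ?normr1//.
    by rewrite -EFinD /K; congr EFin; ring.
  have eW w : (W n w)%:E = ((expR (- (2 * n%:R)))%:E * \sum_(k < 2 ^ n) S k w)%E.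
    by rewrite /W EFinM -sumEFin.
  under eq_integral do rewrite eW.
  have mSS : measurable_fun setT (fun w => \sum_(k < 2 ^ n) S k w)%E.
    exact: emeasurable_sum.
  have SS0 w : setT w -> (0 <= \sum_(k < 2 ^ n) S k w)%E.
    by move=> _; apply: sume_ge0.
  have E0 : (0 <= (expR (- (2 * n%:R)) : R)%:E)%E by rewrite lee_fin expR_ge0.
  rewrite (ge0_integralZl _ _ mSS SS0 E0)// ge0_integral_sum//.
  rewrite (eq_bigr (fun=> K%:E)); last by move=> k _; rewrite ES.
  rewrite sumEFin -EFinM lee_fin sumr_const card_ord.
  rewrite -[K *+ _]mulr_natr mulrCA; apply: ler_wpM2l => //.
  have e2 : 2 ^+ n * 2 ^+ n <= expR (2 * n%:R) :> R.
    rewrite -exprMn [2 * n%:R]mulrC expRM_natl; apply: lerXn2r; rewrite ?nnegrE ?expR_ge0//.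
    have : 1 + 1 <= expR 1 :> R by exact: expR_ge1Dx.
    rewrite (_ : expR 2 = expR 1 * expR 1); last by rewrite -expRD.
    by have := expR_ge0 (1 : R); nra.
  have p0 : 0 < 2 ^+ n :> R by rewrite exprn_gt0.
  rewrite natrX expRN exprVn mulrC ler_pdivrMr ?expR_gt0//.
  by rewrite [leRHS]mulrC ler_pdivlMr.
have half0 : 0 <= 2^-1 :> R by rewrite invr_ge0.
have := ae_eventually_le1 mW W0 EW
  (nneseries_lty (fun n => mulr_ge0 K0 (exprn_ge0 n half0))
    (fun n => sum_half_le n K0)).
apply: filterS => w; apply: filterS => n Wn k kn.
have kW s : `|s| = 1 -> s * Z n k w <= 2 * n%:R.
  move=> s1; rewrite -subr_le0 -ler_expR expR0; apply: le_trans Wn.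
  rewrite expRD mulrC; apply: ler_wpM2l; first exact: expR_ge0.
  rewrite (bigD1 (Ordinal kn))//=; apply: (@le_trans _ _ (expR (1 * Z n k w) + expR (-1 * Z n k w))).
    have [s_ge0|s_lt0] := leP 0 s.
      by rewrite ger0_norm// in s1; rewrite s1 lerDl expR_ge0.
    rewrite ltr0_norm// in s1; rewrite -[s]opprK s1 lerDr expR_ge0//.
  by rewrite lerDl sumr_ge0// => i _; rewrite addr_ge0 ?expR_ge0.
rewrite ler_norml -/(Z n k w).
have := kW 1 (normr1 _); have := kW (-1); rewrite normrN normr1 => /(_ erefl).
by rewrite mul1r mulN1r; lra.
Qed.

(** The finitely many levels that escape the eventual bound are absorbed in the
    random constant. *)
Lemma fbm_ae_modulus : {ae P, forall w, exists2 C : R, 1 <= C &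
  forall n k, (k < 2 ^ n)%N ->
  `|dyadic_increment (B ^~ w) n k| <= C * n.+1%:R * 2 `^ (- (H * n%:R))}.
Proof.
have := fbm_ae_near_modulus; apply: filterS => w [n0 _ hn0].
pose S : R := \sum_(n < n0) \sum_(k < 2 ^ n) `|2 `^ (H * n%:R) * dyadic_increment (B ^~ w) n k|.
have S0 : 0 <= S by apply: sumr_ge0 => n _; apply: sumr_ge0.
exists (2 + S) => [|n k kn]; first by lra.
have e : `|dyadic_increment (B ^~ w) n k| * 2 `^ (H * n%:R) =
    `|2 `^ (H * n%:R) * dyadic_increment (B ^~ w) n k|.
  by rewrite normrM (gtr0_norm (pow2_gt0 _)) mulrC.
rewrite pow2N ler_pdivlMr ?pow2_gt0// e.
have [nn0|n0n] := ltnP n n0.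
- apply: (@le_trans _ _ S).
    rewrite /S (bigD1 (Ordinal nn0))//= (bigD1 (Ordinal kn))//=.
    by rewrite -addrA lerDl addr_ge0// sumr_ge0// => i _; rewrite sumr_ge0.
  have : 1 <= n.+1%:R :> R by rewrite ler1n.
  by nra.
- apply: (le_trans (hn0 n n0n k kn)).
  rewrite -natr1; have : 0 <= n%:R :> R by [].
  by nra.
Qed.

(** The constant [16] makes the exponent of the tail bound [4 * ln n], so that
    the probabilities, of order [n ^- 4], are summable. *)
Lemma fbm_ae_concentrated : {ae P, forall w, \forall n \near \oo,
  `|2 `^ ((2 * H - 1) * n%:R) * quadratic_variation (B ^~ w) n - 1| <=
  16 * fluctuation H n}.
Proof.
pose t n := 16 * fluctuation H n.
have t_small : \forall n \near \oo, 0 < t n <= 2.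
  have c0 : t n @[n --> \oo] --> 0.
    by rewrite -[X in _ --> X](mulr0 16); apply: cvgM; [exact: cvg_cst | exact: cvg_fluctuation].
  near=> n; apply/andP; split; last by near: n; apply: (cvgr_le _ c0).
  rewrite !mulr_gt0 ?pow2_gt0// sqrtr_gt0 ln_gt0// ltr1n.
  by near: n; exact: nbhs_infty_gt.
have [n0 _ hn0] := t_small.
pose D n w := 2 `^ ((2 * H - 1) * n%:R) * quadratic_variation (B ^~ w) n - 1 : R.
have mD n : measurable_fun setT (D n).
  apply: measurable_funB => //; apply: measurable_funM => //.
  rewrite /quadratic_variation; under eq_fun do rewrite big_mkord.
  by apply: measurable_sum => k; apply: measurable_funX; exact: m_increment.
have one_side s : `|s| = 1 -> {ae P, forall w, \forall n \near \oo, s * D n w <= t n}.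
  move=> s1; have s2 : s ^+ 2 = 1 by rewrite -real_normK ?num_real// s1 expr1n.
  pose W n w := if (maxn n0 2 <= n)%N then
    expR (s * t n / (16 * level_norm H n) * (D n w - s * t n)) else 0.
  have mW n : measurable_fun setT (W n).
    rewrite /W; case: (maxn n0 2 <= n)%N => //; apply: measurableT_comp => //.
    by apply: measurable_funM => //; apply: measurable_funB.
  have W0 n w : 0 <= W n w by rewrite /W; case: ifP => // _; exact: expR_ge0.
  have v0 n : 0 <= n%:R^-1 * n.+1%:R^-1 :> R by rewrite mulr_ge0 ?invr_ge0.
  have EW n : (\int[P]_w (W n w)%:E <= (n%:R^-1 * n.+1%:R^-1)%:E)%E.
    rewrite /W; case: (boolP (maxn n0 2 <= n)%N) => [|_]; last by rewrite integral0 lee_fin.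
    rewrite geq_max => /andP[n0n n2]; have tn := hn0 n n0n.
    apply: (le_trans (fbm_concentration hH hB n s1 tn)).
    have np : 0 < n%:R :> R by rewrite ltr0n ltnW.
    rewrite lee_fin.
    have -> : t n ^+ 2 / (32 * level_norm H n) = 4%:R * ln n%:R.
      rewrite /t /fluctuation !exprMn sqr_sqrtr ?ln_ge0 ?ler1n ?(ltnW n2)//.
      rewrite pow2X /level_norm.
      have -> : - hurst_gap H * n%:R * 2 = - (2 * hurst_gap H) * n%:R by ring.
      by field; rewrite gt_eqF// pow2_gt0.
    rewrite expRN expRM_natl lnK ?posrE// -invfM lef_pV2 ?posrE ?mulr_gt0 ?exprn_gt0//.
    rewrite -natrX -natrM ler_nat !expnS expn0 muln1.
    rewrite leq_mul2l; apply/orP; right.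
    apply: (@leq_trans (2 * n)); first by rewrite mul2n -addnn -addn1 leq_add2l ltnW.
    by apply: leq_mul => //; rewrite leq_pmulr// ltnW.
  have := ae_eventually_le1 mW W0 EW (nneseries_lty v0 sum_inv_mul_succ_le).
  apply: filterS => w; move=> h; near=> n.
  have nn : (maxn n0 2 <= n)%N by near: n; exact: nbhs_infty_ge.
  have : W n w <= 1 by near: n; exact: h.
  rewrite /W nn -[leRHS]expR0 ler_expR.
  have tn : 0 < t n by have /andP[] := hn0 n (leq_trans (leq_maxl _ _) nn).
  have q0 : 0 < t n / (16 * level_norm H n) by rewrite divr_gt0// mulr_gt0// level_norm_gt0.
  have -> : s * t n / (16 * level_norm H n) * (D n w - s * t n) =
      t n / (16 * level_norm H n) * (s * D n w - s ^+ 2 * t n) by ring.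
  by rewrite pmulr_rle0// s2 mul1r subr_le0.
have h1 := one_side 1 (normr1 _).
have h2 : {ae P, forall w, \forall n \near \oo, -1 * D n w <= t n}.
  by apply: one_side; rewrite normrN normr1.
apply: filterS2 h1 h2 => w; apply: filterS2 => n.
rewrite mul1r mulN1r => a b; rewrite ler_norml -/(D n w) -/(t n); lra.
Unshelve. all: by end_near. Qed.

End fbm_paths.

(** * Drifts with bounded density *)

Section bounded_drift.
Context {R : realType}.
Variables (f : R -> R) (M : R).
Hypothesis M0 : 0 <= M.
Hypothesis mf : measurable_fun (`[0, 1] : set R) f.
Hypothesis f_le : {ae (@lebesgue_measure R), forall t, 0 <= t <= 1 -> `|f t| <= M}.
Local Notation mu := (@lebesgue_measure R).

Let integral_norm_le (D : set R) : measurable D -> D `<=` `[0, 1] ->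
  (\int[mu]_(x in D) `|(f x)%:E| <= M%:E * mu D)%E.
Proof.
move=> mD D01; apply: (@integral_le_bound _ _ _ mu D (EFin \o f) M%:E mD).
- by apply/measurable_EFinP; apply: measurable_funS mf.
- by rewrite lee_fin.
- have F := ae_filter_ringOfSetsType mu.
  apply: (@filterS _ _ F (fun t : R => 0 <= t <= 1 -> `|f t| <= M)); last exact: f_le.
  by move=> t h /D01 /=; rewrite in_itv/= => /h; rewrite lee_fin.
Qed.

Let integrable01 : mu.-integrable `[0, 1] (EFin \o f).
Proof.
apply/integrableP; split; first exact/measurable_EFinP.
apply: le_lt_trans (integral_norm_le _ _) _ => //.
by rewrite lebesgue_measure_itv/= lte_fin ltr01 oppr0 adde0 -EFinM ltry.
Qed.

Lemma integral_lipschitz s t : 0 <= s -> s <= t -> t <= 1 ->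
  `|(\int[mu]_(u in `[0%R, t]) f u)%R - (\int[mu]_(u in `[0%R, s]) f u)%R| <= M * (t - s).
Proof.
move=> s0 st t1; have t0 := le_trans s0 st.
have I0t : mu.-integrable `[0, t] (EFin \o f).
  by apply: integrableS integrable01 => //; apply: subset_itvl; rewrite bnd_simp.
have sub : `]s, t] `<=` `[0, 1].
  by apply: subset_itv; rewrite bnd_simp.
have Ist : mu.-integrable `]s, t] (EFin \o f) by apply: integrableS integrable01.
rewrite Rintegral_itvB ?bnd_simp//.
apply: (le_trans (le_normr_Rintegral _ Ist)) => //.
have b : (\int[mu]_(x in `]s, t]) `|(f x)%:E| <= (M * (t - s))%:E)%E.
  rewrite EFinM.
  have -> : ((t - s)%:E = mu (`]s, t]%classic : set R))%E.
    rewrite lebesgue_measure_itv/= lte_fin; case: ltP => // ts.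
    by have -> : t = s by [apply/eqP; rewrite eq_le ts]; rewrite subrr.
  exact: integral_norm_le.
rewrite -lee_fin fineK//.
rewrite ge0_fin_numE; last by apply: integral_ge0 => u _; rewrite lee_fin.
exact: le_lt_trans b (ltry _).
Qed.

End bounded_drift.

Section drift_density.
Context {R : realType} {d : measure_display} {T : measurableType d}.
Variables (P : probability T R) (H : R) (zeta : R -> T -> R).

(** Progressive measurability at time one is joint measurability on the unit
    interval, which passes to the sections. *)
Lemma progressive_section (G : R -> set (set T)) w :
  progressively_measurable G zeta -> measurable_fun (`[0, 1] : set R) (zeta ^~ w).
Proof.
move=> /(_ 1); rewrite ler01 lexx => /(_ isT) h.
pose G1 := g_sigma_algebraType (G 1); pose e (s : R) : R * G1 := (s, w).
have me : measurable_fun (`[0, 1] : set R) e.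
  by apply: measurable_funTS; exact: (@pair2_measurable _ _ R G1 w).
have mF : measurable ((`[0, 1] : set R) `*` [set: G1]) by exact: measurableX.
have sub : e @` `[0, 1] `<=` `[0, 1] `*` [set: G1] by move=> _ [s s01 <-].
exact: (measurable_comp mF sub h me).
Qed.

(** For [H > 2^-1] the Hoelder exponent is positive, so that the density stays
    within a bounded distance of its initial value. *)
Lemma ae_bounded_density
    (zeta_bounded : H <= 2^-1 -> exists C : {RV P >-> R},
       {ae P, forall w, {ae (@lebesgue_measure R), forall t,
          0 <= t <= 1 -> `|zeta t w| <= C w}})
    (zeta_hoelder : 2^-1 < H ->
       {ae P, forall w,
          exists2 a : R, 2 * H - 1 < a & hoelder_on01 a (zeta ^~ w)}) :
  {ae P, forall w, exists2 M : R, 0 <= M & {ae (@lebesgue_measure R), forall t,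
     0 <= t <= 1 -> `|zeta t w| <= M}}.
Proof.
have [hH|hH] := leP H 2^-1.
  have [C h] := zeta_bounded hH.
  apply: filterS h => w h; exists `|C w| => //.
  have F := ae_filter_ringOfSetsType (@lebesgue_measure R).
  apply: (@filterS _ _ F _ _ _ h) => t {}h t01.
  exact: le_trans (h t01) (ler_norm _).
apply: filterS (zeta_hoelder hH) => w [a aH [K hK]].
exists (`|K| + `|zeta 0 w|); first by rewrite addr_ge0.
apply: aeW => t /andP[t0 t1].
have a0 : 0 <= a by lra.
rewrite -[zeta t w](subrK (zeta 0 w)); apply: le_trans (ler_normD _ _) _.
rewrite lerD2r; apply: le_trans (hK t 0 _ _) _; rewrite ?t0 ?t1 ?lexx ?ler01//.
rewrite subr0 (ger0_norm t0).
have p1 : t `^ a <= 1.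
  have -> : (1 : R) = 1 `^ a by rewrite powR1.
  by apply: ge0_ler_powR; rewrite ?nnegrE.
apply: le_trans (ler_wpM2r (powR_ge0 _ _) (ler_norm K)) _.
by rewrite -[leRHS]mulr1; apply: ler_wpM2l.
Qed.

End drift_density.

(** * Stability under Lipschitz perturbations *)

Section lipschitz_perturbation.
Context {R : realType}.
Variables (H : R) (hH : 0 < H < 1) (x0 : R) (b y : R -> R) (M : R).
Hypothesis M0 : 0 <= M.
Hypothesis y_lip : forall s t, 0 <= s -> s <= t -> t <= 1 ->
  `|y t - y s| <= M * (t - s).

Local Notation x := (fun t => x0 + b t + y t).

Let incrementD n k :
  dyadic_increment x n k = dyadic_increment b n k + dyadic_increment y n k.
Proof. by rewrite /dyadic_increment; ring. Qed.

Let increment_le n k : (k < 2 ^ n)%N ->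
  `|dyadic_increment y n k| <= M * 2 `^ (- n%:R).
Proof.
move=> kn; have N0 : (0 : R) < 2 ^+ n by rewrite exprn_gt0.
have -> : 2 `^ (- n%:R) = k.+1%:R / 2 ^+ n - k%:R / 2 ^+ n :> R.
  by rewrite -mulrBl -(natr1 k) addrAC subrr add0r mul1r pow2N pow2n.
apply: y_lip.
- by rewrite divr_ge0// ltW.
- by rewrite ler_pM2r ?invr_gt0// ler_nat.
- by rewrite ler_pdivrMr// mul1r -natrX ler_nat.
Qed.

Lemma perturbed_modulus C : (forall n k, (k < 2 ^ n)%N ->
    `|dyadic_increment b n k| <= C * n.+1%:R * 2 `^ (- (H * n%:R))) ->
  forall n k, (k < 2 ^ n)%N ->
    `|dyadic_increment x n k| <= (C + M) * n.+1%:R * 2 `^ (- (H * n%:R)).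
Proof.
move=> hb n k kn; rewrite incrementD; apply: le_trans (ler_normD _ _) _.
rewrite !mulrDl; apply: lerD; first exact: hb.
apply: le_trans (increment_le kn) _; rewrite -mulrA; apply: ler_wpM2l => //.
have p : (2 : R) `^ (- n%:R) <= 2 `^ (- (H * n%:R)).
  apply: pow2_le; rewrite lerN2 -[leRHS]mul1r; apply: ler_wpM2r => //.
  by case/andP: hH => _ /ltW.
apply: le_trans p _; rewrite -[leLHS]mul1r.
by apply: ler_wpM2r; [exact: powR_ge0 | rewrite ler1n].
Qed.

(** The weight that balances the two terms of Young's inequality below. *)
Let eta n : R := 2 `^ (- (1 - H) * n%:R).

Let quadratic_variation_perturbed n :
  `|quadratic_variation x n - quadratic_variation b n| <=
  eta n * quadratic_variation b n +
  2 ^+ n * ((M * 2 `^ (- n%:R)) ^+ 2 / eta n + (M * 2 `^ (- n%:R)) ^+ 2).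
Proof.
have e0 : 0 < eta n by exact: pow2_gt0.
set D := M * _; have D0 : 0 <= D by rewrite mulr_ge0// powR_ge0.
rewrite /quadratic_variation -sumrB; apply: le_trans (ler_norm_sum _ _ _) _.
rewrite mulr_sumr -natrX.
rewrite [X in _ + X](_ : _ = \sum_(0 <= k < 2 ^ n) (D ^+ 2 / eta n + D ^+ 2)); last first.
  by rewrite sumr_const_nat subn0 mulr_natl.
rewrite -big_split/=; apply: ler_sum_nat => k /andP[_ kn].
rewrite incrementD; set a := dyadic_increment b n k.
have := increment_le kn; rewrite -/D; set e := dyadic_increment y n k => eD.
have -> : (a + e) ^+ 2 - a ^+ 2 = 2 * (a * e) + e ^+ 2 by ring.
have e2 : e ^+ 2 <= D ^+ 2.
  by rewrite -(real_normK (num_real e)) lerXn2r ?nnegrE.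
apply: le_trans (ler_normD _ _) _; rewrite (ger0_norm (sqr_ge0 e)) addrA.
apply: lerD => //.
have ae : `|2 * (a * e)| <= eta n * a ^+ 2 + e ^+ 2 / eta n.
  have c0 : eta n != 0 by rewrite gt_eqF.
  have p : 0 <= (eta n * a + e) ^+ 2 / eta n by rewrite divr_ge0 ?sqr_ge0// ltW.
  have q : 0 <= (eta n * a - e) ^+ 2 / eta n by rewrite divr_ge0 ?sqr_ge0// ltW.
  have pE : (eta n * a + e) ^+ 2 / eta n = eta n * a ^+ 2 + e ^+ 2 / eta n + 2 * (a * e).
    by field.
  have qE : (eta n * a - e) ^+ 2 / eta n = eta n * a ^+ 2 + e ^+ 2 / eta n - 2 * (a * e).
    by field.
  by rewrite ler_norml; lra.
by apply: le_trans ae _; rewrite lerD2l ler_pM2r ?invr_gt0.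
Qed.

(** The increments of the perturbation are [2 ^- n], against [2 `^ (- H * n)] for
    the path, so the normalised quadratic variation moves by a multiple of
    [eta n], whose exponent [1 - H] is at least [hurst_gap]. *)
Lemma perturbed_concentration kap :
  (\forall n \near \oo,
    `|2 `^ ((2 * H - 1) * n%:R) * quadratic_variation b n - 1| <= kap * fluctuation H n) ->
  \forall n \near \oo,
    `|2 `^ ((2 * H - 1) * n%:R) * quadratic_variation x n - 1| <=
    (kap + 1) * fluctuation H n.
Proof.
move=> hb.
have hgap : hurst_gap H <= 1 - H by rewrite ge_min lexx orbT.
have small : \forall n \near \oo, kap * fluctuation H n <= 1.
  have k0 : kap * fluctuation H n @[n --> \oo] --> kap * 0.
    by apply: cvgM; [exact: cvg_cst | exact: cvg_fluctuation].
  by move: k0; rewrite mulr0 => /cvgr_le; apply; exact: ltr01.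
near=> n.
have h1 : `|2 `^ ((2 * H - 1) * n%:R) * quadratic_variation b n - 1| <= kap * fluctuation H n.
  by near: n.
have h2 : kap * fluctuation H n <= 1 by near: n.
have h3 : (2 + 2 * M ^+ 2) * eta n <= fluctuation H n.
  by near: n; exact: near_le_fluctuation.
have := quadratic_variation_perturbed n; move: h1.
set A := 2 `^ ((2 * H - 1) * n%:R); set qb := quadratic_variation b n.
set qx := quadratic_variation x n => h1 h4.
have A0 : 0 < A by exact: pow2_gt0.
have e0 : 0 < eta n by exact: pow2_gt0.
have e1 : eta n <= 1.
  rewrite -[leRHS](powRr0 (2 : R)); apply: pow2_le.
  by rewrite mulNr oppr_le0 mulr_ge0//; case/andP: hH; lra.
have AeE : A * (2 ^+ n * (2 `^ (- n%:R)) ^+ 2) = eta n ^+ 2.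
  rewrite -pow2n !pow2X /A /eta -!pow2D; congr (_ `^ _); ring.
have AE : A * (2 ^+ n * ((M * 2 `^ (- n%:R)) ^+ 2 / eta n + (M * 2 `^ (- n%:R)) ^+ 2)) =
    M ^+ 2 * (eta n + eta n ^+ 2).
  transitivity (M ^+ 2 * ((A * (2 ^+ n * (2 `^ (- n%:R)) ^+ 2)) / eta n +
    A * (2 ^+ n * (2 `^ (- n%:R)) ^+ 2))); first by ring.
  by rewrite AeE expr2 mulfK// gt_eqF.
have h5 : `|A * qx - A * qb| <= eta n * (A * qb) + M ^+ 2 * (eta n + eta n ^+ 2).
  rewrite -mulrBr normrM (gtr0_norm A0) -AE.
  apply: le_trans (ler_wpM2l (ltW A0) h4) _.
  by rewrite mulrDr mulrCA.
have AB : A * qb <= 2 by move: h1; rewrite ler_norml; lra.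
have h6 : eta n * (A * qb) <= eta n * 2 by apply: ler_wpM2l => //; exact: ltW.
have h7 : M ^+ 2 * (eta n + eta n ^+ 2) <= M ^+ 2 * (eta n + eta n).
  apply: ler_wpM2l; first exact: sqr_ge0.
  by rewrite lerD2l expr2 -[leRHS]mul1r ler_wpM2r// ltW.
have -> : A * qx - 1 = (A * qx - A * qb) + (A * qb - 1) by ring.
apply: le_trans (ler_normD _ _) _; lra.
Unshelve. all: by end_near. Qed.

Lemma perturbed_continuous : {within `[0, 1], continuous b} ->
  {within `[0, 1], continuous x}.
Proof.
move=> cb; apply: within_continuousD.
  by apply: within_continuousD cb => t; exact: cvg_cst.
apply/subspace_continuousP => t; rewrite /= in_itv/= => /andP[t0 t1].
apply/cvgrPdist_le => e e0; rewrite near_withinE.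
have [r r0 hr] : \forall s \near t, `|t - s| < e / (M + 1).
  by apply: (@cvgr_dist_lt _ _ _ (nbhs t) _ id t) => //; rewrite divr_gt0 ?ltr_wpDl.
exists r => // s /hr/= st; rewrite in_itv/= => s01.
have M1 : 0 < M + 1 by rewrite ltr_wpDl.
move: st; rewrite ltr_pdivlMr// mulrC mulrDl mul1r => st.
have p := normr_ge0 (t - s).
have : `|y t - y s| <= M * `|t - s|; last by lra.
case/andP: s01 => s0 s1; have [ts|/ltW ts] := leP s t.
  by rewrite (ger0_norm (_ : 0 <= t - s)) ?subr_ge0//; exact: y_lip.
by rewrite distrC [X in _ <= _ * X]distrC [X in _ <= _ * X]ger0_norm ?subr_ge0//; exact: y_lip.
Qed.

End lipschitz_perturbation.

Theorem theorem5p1 (R : realType) (d : measure_display) (T : measurableType d)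
    (P : probability T R) (H : R) (hH : 0 < H < 1) (x0 : R)
    (B : R -> {RV P >-> R}) (hB : fractional_brownian_motion H B)
    (zeta : R -> T -> R)
    (zeta_prog : progressively_measurable (natural_filtration_gen B) zeta)
    (zeta_bounded : H <= 2^-1 -> exists C : {RV P >-> R},
       {ae P, forall w, {ae (@lebesgue_measure R), forall t,
          0 <= t <= 1 -> `|zeta t w| <= C w}})
    (zeta_hoelder : 2^-1 < H ->
       {ae P, forall w,
          exists2 a : R, 2 * H - 1 < a & hoelder_on01 a (zeta ^~ w)}) :
  let X := fun w t => drifted x0 B zeta t w in
  [/\ {ae P, forall w, reverse_jensen (X w) /\ roughness_exponent (X w) H},
      {ae P, forall w, rough_estimator (X w) n @[n --> \oo] --> H}
    & exists kappa : R, 0 < kappa /\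
        {ae P, forall w,
           (limn_esup (fun n => (`|rough_estimator (X w) n - H| / rate H n)%:E)
            <= kappa%:E)%E}].
Proof.
move=> X.
have ae_path : {ae P, forall w,
    [/\ exists2 C : R, 1 <= C & forall n k, (k < 2 ^ n)%N ->
          `|dyadic_increment (X w) n k| <= C * n.+1%:R * 2 `^ (- (H * n%:R)),
        \forall n \near \oo,
          `|2 `^ ((2 * H - 1) * n%:R) * quadratic_variation (X w) n - 1| <=
          (16 + 1) * fluctuation H n
      & {within `[0, 1], continuous (X w)}]}.
  have [_ _ _ cB] := hB.
  have base : {ae P, forall w, (exists2 C : R, 1 <= C & forall n k, (k < 2 ^ n)%N ->
      `|dyadic_increment (B ^~ w) n k| <= C * n.+1%:R * 2 `^ (- (H * n%:R))) /\
      \forall n \near \oo,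
        `|2 `^ ((2 * H - 1) * n%:R) * quadratic_variation (B ^~ w) n - 1| <=
        16 * fluctuation H n}.
    apply: filterS2 (fbm_ae_modulus hH hB) (fbm_ae_concentrated hH hB) => w h1 h2.
    by split.
  apply: filterS3 base cB (ae_bounded_density zeta_bounded zeta_hoelder).
  move=> w [[C C1 modulus] concentrated] cBw [M M0 hM].
  have lip := integral_lipschitz M0 (progressive_section w zeta_prog) hM.
  split.
  - exists (C + M); first by rewrite ler_wpDr.
    exact: (perturbed_modulus hH x0 M0 lip modulus).
  - exact: (perturbed_concentration hH x0 M0 lip concentrated).
  - exact: (perturbed_continuous (x0 := x0) M0 lip cBw).
split.
- apply: filterS ae_path => w [[C C1 modulus] concentrated cX]; split.
    exact: (path_reverse_jensen hH C1 modulus concentrated).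
  exact: (path_roughness_exponent hH C1 modulus concentrated cX).
- apply: filterS ae_path => w [[C C1 modulus] concentrated _].
  exact: (path_consistent hH C1 modulus concentrated).
- exists ((16 + 1 + 1) / ln 2); split.
    by rewrite divr_gt0 ?ln_gt0 ?ltr1n.
  apply: filterS ae_path => w [[C C1 modulus] concentrated _].
  by apply: (path_rate hH C1 modulus concentrated).
Qed.
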